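(* For every partition $\nu$ of a positive integer $n$ and every nonnegative integer $m$, $S_q(n,m;\nu)=\tilde S_q(n,m;\nu)$.
   Context: $q$ is a formal variable; $[n]_q=1+q+\cdots+q^{n-1}$, $[n]_q!=\prod_{i=1}^n[i]_q$, ${n\brack \beta_1,\beta_2,\ldots}_q=[n]_q!/\prod_j[\beta_j]_q!$. Definition of $S_q(n,m;\nu)$: $S_q(n,m;\nu)=\sum_{\mu\vdash n,\ \mu_1=m}q^{\sum_{j\ge2}\binom{\mu_j}{2}}b_{\mu\nu}(q)$, where $b_{\mu\nu}(q)=\sum_{T\in\mathrm{SSYT}(\mu,\nu)}r_q(T)s_q(T)$, the sum being over semistandard tableaux of shape $\mu$ and content $\nu$ (entry $i$ appearing $\nu_i$ times, rows weakly and columns strictly increasing). If $b_{ij}$ is the entry of $T$ in row $i$, column $j$, then for each cell with $i\ge2$, $r_{ij}(T)=\#\{j':j'\ge j,\ b_{i-1,j'}<b_{ij}\}$, and $r_q(T)=\prod_{(i,j):\,i\ge2}[r_{ij}(T)]_q$ over cells of $T$. If $\beta^i_j$ is the number of entries $i$ in row $j$ of $T$, then $s_q(T)=\prod_{i\ge1}{\nu_i\brack\beta^i_1,\beta^i_2,\ldots}_q$. Definition of $\tilde S_q(n,m;\nu)$: the staircase board of size $n$ has squares (row $i$, column $j$) for $1\le i<j\le n$, with rows numbered $1,\ldots,n-1$ from bottom to top and columns numbered $2,\ldots,n$ from left to right. A set partition $\mathcal{A}$ of $[n]$ gives a placement of nonattacking rooks $P$: a rook is put in row $i$ and column $j$ whenever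 $i<j$ are consecutive elements of the same block of $\mathcal{A}$. A square is cancelled if it lies below some rook in the same column or to the right of some rook in the same row. $\rho(\mathcal{A})=\rho(P)$ is the number of squares of the board that neither contain a rook nor are cancelled. Let $\mathcal{A}_\nu$ be the set partition of $[n]$ with blocks $A_i=\{\nu_1+\cdots+\nu_{i-1}+1,\ldots,\nu_1+\cdots+\nu_i\}$. Then $\tilde S_q(n,m;\nu)=\sum_{\mathcal{A}}q^{\rho(\mathcal{A})-\binom m2}$, summed over all set partitions $\mathcal{A}$ of $[n]$ with $m$ blocks such that each block of $\mathcal{A}$ meets each block of $\mathcal{A}_\nu$ in at most one element. *)

(* Defs.v *)
From mathcomp Require Import all_boot all_order all_algebra.

Set Implicit Arguments.
Unset Strict Implicit.
Unset Printing Implicit Defensive.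

Import GRing.Theory.

(* All indices start from 0: rows and columns of tableaux and boards, parts of
   partitions, entries of tableaux and elements of [n] are shifted by one with
   respect to the usual 1-based numbering.  The definitions below only compare
   such indices, so the shift is harmless. *)

Definition is_part (n : nat) (mu : seq nat) : bool :=
  [&& sorted geq mu, all (leq 1) mu & sumn mu == n].

(* The type {bseq n of 'I_n.+1} is finite and, through this function, contains
   every partition of n exactly once (see [is_part_bseq]). *)
Definition seq_of_bseq (n : nat) (mu : {bseq n of 'I_n.+1}) : seq nat :=
  [seq val k | k <- mu].

Lemma is_part_bseq (n : nat) (mu : seq nat) :
  is_part n mu -> exists! mu' : {bseq n of 'I_n.+1}, seq_of_bseq mu' = mu.
Proof.
case/and3P=> _ mu_gt0 /eqP mu_sum.
have size_mu : size mu <= n.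
  rewrite -mu_sum; elim: mu mu_gt0 {mu_sum} => //= k mu IH /andP[k_gt0 /IH].
  by rewrite -add1n; apply: leq_add.
have mu_le k : k \in mu -> k < n.+1.
  rewrite ltnS -mu_sum; elim: mu {mu_gt0 mu_sum size_mu} => //= l mu IH.
  rewrite inE => /orP[/eqP-> | /IH le_k]; first exact: leq_addr.
  by apply: leq_trans le_k (leq_addl _ _).
have size_mu' : size [seq inord k : 'I_n.+1 | k <- mu] <= n.
  by rewrite size_map.
exists (Bseq size_mu'); split=> [|mu' def_mu].
  rewrite /seq_of_bseq /= -map_comp -[RHS]map_id.
  by apply/eq_in_map => k /mu_le lt_k; rewrite /= inordK.
apply: val_inj; rewrite /= -def_mu /seq_of_bseq -map_comp -[RHS]map_id.
by apply: eq_map => k; rewrite /= inord_val.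
Qed.

(* The cells of the diagram of mu: a row i together with a column < mu_i. *)
Definition cell (mu : seq nat) : finType :=
  {i : 'I_(size mu) & 'I_(nth 0 mu i)} : finType.

Definition crow (mu : seq nat) (c : cell mu) : nat := val (tag c).
Definition ccol (mu : seq nat) (c : cell mu) : nat := val (tagged c).

(* Only indices of parts of nu can occur as entries of a tableau of content
   nu. *)
Definition filling (mu nu : seq nat) : finType :=
  {ffun cell mu -> 'I_(size nu)} : finType.

Definition is_ssyt (mu nu : seq nat) (T : filling mu nu) : bool :=
  [&& [forall c : cell mu, forall d : cell mu,
         (crow c == crow d) && (ccol c <= ccol d) ==> (T c <= T d)],
      [forall c : cell mu, forall d : cell mu,
         (ccol c == ccol d) && (crow c < crow d) ==> (T c < T d)]
    & [forall k : 'I_(size nu), #|[set c | T c == k]| == nth 0 nu k]].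

(* r_{ij}(T), for c the cell in row i and column j. *)
Definition rcount (mu nu : seq nat) (T : filling mu nu) (c : cell mu) : nat :=
  #|[set d : cell mu |
      [&& (crow d).+1 == crow c, ccol c <= ccol d & T d < T c]]|.

(* The number of entries equal to k in row j. *)
Definition row_mult (mu nu : seq nat) (T : filling mu nu)
    (k : 'I_(size nu)) (j : nat) : nat :=
  #|[set c : cell mu | (crow c == j) && (T c == k)]|.

(* A square of the staircase board is a pair (row, column) with row < column;
   rows are numbered from bottom to top, columns from left to right. *)
Definition board (n : nat) : {set 'I_n * 'I_n} :=
  [set s : 'I_n * 'I_n | s.1 < s.2].

Definition rooks (n : nat) (A : {set {set 'I_n}}) : {set 'I_n * 'I_n} :=
  [set s : 'I_n * 'I_n in board n |
    [exists B in A, [&& s.1 \in B, s.2 \in B &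
       ~~ [exists k in B, s.1 < k < s.2]]]].

Definition cancelled (n : nat) (P : {set 'I_n * 'I_n}) (s : 'I_n * 'I_n) :
    bool :=
  [exists t in P, ((s.2 == t.2) && (s.1 < t.1))
               || ((s.1 == t.1) && (t.2 < s.2))].

Definition rho (n : nat) (A : {set {set 'I_n}}) : nat :=
  #|[set s : 'I_n * 'I_n in board n | (s \notin rooks A) && ~~ cancelled (rooks A) s]|.

Definition nu_block (n : nat) (nu : seq nat) (i : nat) : {set 'I_n} :=
  [set x : 'I_n | sumn (take i nu) <= x < sumn (take i.+1 nu)].

Definition A_nu (n : nat) (nu : seq nat) : {set {set 'I_n}} :=
  [set nu_block n nu i | i : 'I_(size nu)].

Local Open Scope ring_scope.

(* The q-analogues are defined for any element q of a field, but the divisions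
   are only meaningful when no [k]_q with k > 0 vanishes, as is the case for
   the indeterminate [qvar] below. *)

Definition qint (F : fieldType) (q : F) (k : nat) : F := \sum_(i < k) q ^+ i.

Definition qfact (F : fieldType) (q : F) (k : nat) : F :=
  \prod_(1 <= i < k.+1) qint q i.

Definition qmultinomial (F : fieldType) (q : F) (k : nat) (bs : seq nat) : F :=
  qfact q k / \prod_(b <- bs) qfact q b.

Definition r_q (F : fieldType) (q : F) (mu nu : seq nat)
    (T : filling mu nu) : F :=
  \prod_(c : cell mu | (0 < crow c)%N) qint q (rcount T c).

Definition s_q (F : fieldType) (q : F) (mu nu : seq nat)
    (T : filling mu nu) : F :=
  \prod_(k < size nu)
    qmultinomial q (nth 0%N nu k) [seq row_mult T k j | j <- iota 0 (size mu)].

Definition b_q (F : fieldType) (q : F) (mu nu : seq nat) : F :=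
  \sum_(T : filling mu nu | is_ssyt T) r_q q T * s_q q T.

Definition S_q (F : fieldType) (q : F) (n m : nat) (nu : seq nat) : F :=
  \sum_(mu : {bseq n of 'I_n.+1} |
         is_part n (seq_of_bseq mu) && (nth 0%N (seq_of_bseq mu) 0 == m))
    q ^+ (\sum_(1 <= j < size mu) 'C(nth 0%N (seq_of_bseq mu) j, 2))
    * b_q q (seq_of_bseq mu) nu.

(* The exponent is a difference of integers, not a truncated subtraction. *)
Definition St_q (F : fieldType) (q : F) (n m : nat) (nu : seq nat) : F :=
  \sum_(A : {set {set 'I_n}} |
         [&& partition A [set: 'I_n], #|A| == m
           & [forall B in A, forall C in A_nu n nu, (#|B :&: C| <= 1)%N]])
    q ^ ((rho A)%:Z - ('C(m, 2))%:Z).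

(* The formal variable, in the field Q(q) of rational functions. *)
Definition qvar : {fraction {poly rat}} := @FracField.tofrac {poly rat} 'X.

(* Main.v *)
Require Import Defs.
From mathcomp Require Import all_boot all_order all_algebra.
From mathcomp Require Import zify ring.

(* Both sides are built one part c of nu at a time, and satisfy the same
   recurrence. On the tableau side, the largest entries form a horizontal
   strip; its weight is, up to a factor depending only on the first row, a
   product over the rows i >= 2 of terms q^(C(b,2) + a b) [d choose b]_q,
   where a is the length of row i before the strip is added, a + d that of
   row i - 1 and b the number of new cells. These are coefficients of
   prod_(a <= s < a + d) (1 + q^s X), by the q-binomial theorem, and the
   intervals [a, a + d) of the successive rows tile [0, m'), where m' is the
   length of the first row. So the sum over all strips depends on the old
   diagram only through m'. On the rook side, an element joining a set
   partition with m blocks either opens a new block, with weight q^m, or is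
   put after the maximum of an old block, with weight q to the number of
   larger block maxima; as the elements of a block of A_nu must stay apart,
   the t-th element of such a block (counting from 0) gets total weight
   q^t [m - t]_q in the second case. *)

Set Implicit Arguments.
Unset Strict Implicit.
Unset Printing Implicit Defensive.
Import Order.TTheory GRing.Theory Num.Theory.
Local Open Scope ring_scope.

(** * q-binomial coefficients and the common recurrence *)

Section QAnalogues.

Variables (F : fieldType) (q : F).

(** The Gaussian binomial, encoded by a q-Pascal rule so that no division enters. *)
Fixpoint qbin (n k : nat) : F :=
  match n, k with
  | _, 0 => 1
  | 0, _.+1 => 0
  | n'.+1, k'.+1 => qbin n' k + q ^+ (n' - k') * qbin n' k'
  end.

(** The falling product [n][n-1]...[n-k+1]; for k > n it contains the factor [0] and vanishes. *)
Definition qffact (n k : nat) : F := \prod_(s < k) qint q (n - s).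

(** Weight for passing from m' to m when a part c is added. Here r = m' + c - m counts the new cells
    outside the first row, or the new elements that join old blocks; the guard makes r a true
    difference with r <= c. *)
Definition strip_coef (c m' m : nat) : F :=
  if (m' <= m <= m' + c)%N then
    q ^+ 'C(m' + c - m, 2) * qbin c (m' + c - m) * qffact m' (m' + c - m)
  else 0.

Lemma qint0 : qint q 0 = 0.
Proof. by rewrite /qint big_ord0. Qed.

Lemma qintD a b : qint q (a + b) = qint q a + q ^+ a * qint q b.
Proof.
rewrite /qint big_split_ord /= mulr_sumr; congr (_ + _).
by apply: eq_bigr => i _; rewrite exprD.
Qed.

Lemma qbin0 n : qbin n 0 = 1. Proof. by case: n. Qed.

Lemma qbin_small n k : (n < k)%N -> qbin n k = 0.
Proof.
elim: n k => [|n IH] [|k] //= nk.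
by rewrite !IH ?mulr0 ?addr0 // ltnW.
Qed.

Lemma qffact_small n k : (n < k)%N -> qffact n k = 0.
Proof.
move=> nk; rewrite /qffact (bigD1 (Ordinal nk)) //=.
by rewrite subnn qint0 mul0r.
Qed.

Lemma qffactS n k : qffact n k.+1 = qffact n k * qint q (n - k).
Proof. by rewrite /qffact big_ord_recr. Qed.

Lemma qfactS k : qfact q k.+1 = qfact q k * qint q k.+1.
Proof. by rewrite /qfact big_nat_recr. Qed.

Lemma qfact0 : qfact q 0 = 1. Proof. by rewrite /qfact big_geq. Qed.

Lemma qffact_qbin n k : qffact n k = qbin n k * qfact q k.
Proof.
elim: n k => [|n IH] [|k]; rewrite ?qbin0 ?qfact0 ?mulr1 //.
- by rewrite /qffact big_ord0.
- by rewrite qffact_small //= mul0r.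
- by rewrite /qffact big_ord0.
have [nk|kn] := ltnP n k; first by rewrite qffact_small // qbin_small ?mul0r.
(* The largest factor [n+1] is split off; writing it as [n-k] + q^(n-k) [k+1] yields the two terms
   of the q-Pascal rule. *)
have -> : qffact n.+1 k.+1 = qint q n.+1 * qffact n k.
  by rewrite /qffact big_ord_recl.
rewrite /= mulrDl -IH qffactS qfactS.
transitivity (qffact n k * (qint q (n - k) + q ^+ (n - k) * qint q k.+1)).
  by rewrite -qintD mulrC; congr (_ * qint q _); lia.
by rewrite [qffact n k in RHS]IH !IH; ring.
Qed.

Lemma qfact_qffact c r : (r <= c)%N -> qfact q c = qffact c r * qfact q (c - r).
Proof.
elim: r => [|r IH] rc; first by rewrite /qffact big_ord0 mul1r subn0.
rewrite IH; last exact: ltnW.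
rewrite qffactS -mulrA; congr (_ * _).
by rewrite (_ : (c - r = (c - r.+1).+1)%N) ?qfactS 1?mulrC //; lia.
Qed.

(** Multiplying by the factor t = d reproduces the q-Pascal rule on coefficients, because C(i+1,2) +
    (d-i) = C(i,2) + d. *)
Lemma qbinomial_theorem (y : F) d :
  \prod_(t < d) (1 + (y * q ^+ t) *: 'X) =
  \sum_(b < d.+1) (q ^+ 'C(b, 2) * qbin d b * y ^+ b) *: 'X^b.
Proof.
elim: d => [|d IH].
  by rewrite big_ord0 big_ord_recl big_ord0 /= bin0n expr0 !mulr1 scale1r addr0.
rewrite big_ord_recr /= IH mulrDr mulr1.
rewrite [in RHS]big_ord_recl /= !expr0 !mulr1.
rewrite [X in _ = _ + X](eq_bigr (fun i : 'I_d.+1 =>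
  (q ^+ 'C(i.+1, 2) * qbin d i.+1 * y ^+ i.+1) *: 'X^(i.+1) +
  (q ^+ 'C(i.+1, 2) * q ^+ (d - i) * qbin d i * y ^+ i.+1) *: 'X^(i.+1))); last first.
  by move=> i _; rewrite /bump /= add1n -scalerDl; congr (_ *: _); ring.
rewrite big_split /= addrA; congr (_ + _).
  rewrite big_ord_recl /= qbin0 expr0 !mulr1; congr (_ + _).
  by rewrite big_ord_recr /= qbin_small // mulr0 mul0r scale0r addr0.
rewrite mulr_suml; apply: eq_bigr => i _.
rewrite -scalerAl -scalerAr scalerA -exprSr; congr (_ *: _).
have -> : (q ^+ 'C(i.+1, 2) * q ^+ (d - i) = q ^+ 'C(i, 2) * q ^+ d).
  rewrite -!exprD; congr (_ ^+ _); rewrite binS bin1.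
  have := ltn_ord i; lia.
by rewrite exprS; ring.
Qed.

Lemma strip_coef0 m' m : strip_coef 0 m' m = (m' == m)%:R.
Proof.
rewrite /strip_coef addn0 -eqn_leq; case: eqP => // ->.
by rewrite subnn /qffact big_ord0 !mulr1.
Qed.

(** The last of c + 1 new elements either joins an old block, with weight q^c [m-c], or opens a
    block. Algebraically this is the q-Pascal rule for [qbin c.+1 r.+1]. *)
Lemma strip_coefS c m' m :
  strip_coef c.+1 m' m =
    q ^+ c * qint q (m - c) * strip_coef c m' m
    + (if m is m1.+1 then strip_coef c m' m1 else 0).
Proof.
have Hdiag r k : (r <= c)%N ->
  q ^+ 'C(r.+1, 2) * qbin c.+1 r.+1 * qffact k r.+1 =
  q ^+ c * qint q (k - r) * (q ^+ 'C(r, 2) * qbin c r * qffact k r)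
  + q ^+ 'C(r.+1, 2) * qbin c r.+1 * qffact k r.+1.
  move=> rc; rewrite qffactS /=.
  have -> : q ^+ c = q ^+ (c - r) * q ^+ r by rewrite -exprD subnK.
  by rewrite binS bin1 exprD; ring.
case: m => [|m1].
  rewrite /strip_coef addr0 leqn0; case: m' => [|m'] /=; last by rewrite mulr0.
  rewrite !add0n !subn0 /=; case: c {Hdiag} => [|c].
    by rewrite qint0 mulr0 mul0r qffact_small ?mulr0.
  by rewrite !qffact_small // !mulr0.
rewrite /strip_coef.
have [lt1|le1] := ltnP m1.+1 m'.
  by rewrite [X in _ = _ + X]ifF ?mulr0 ?addr0 //; lia.
have [eqm|ltm] := leqP m' m1; last first.
  have -> : m1.+1 = m' by lia.
  rewrite ?leqnn ?addr0 ?leq_addr /=.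
  rewrite !addKn Hdiag //.
  by rewrite (qbin_small (ltnSn c)) ?mulr0 ?mul0r addr0.
have [b1|b1] := leqP m1.+1 (m' + c).
  have -> : (m1.+1 <= m' + c.+1)%N by lia.
  have -> : (m1 <= m' + c)%N by lia.
  have -> : (m' + c.+1 - m1.+1 = (m' + c - m1.+1).+1)%N by lia.
  have -> : (m' + c - m1 = (m' + c - m1.+1).+1)%N by lia.
  rewrite Hdiag; last lia.
  (* With r = m' + c - (m1 + 1), the factors [m' - r] and [m1 + 1 - c] agree if r <= m'; otherwise
     the falling products vanish. *)
  have [lem|ltm] := leqP (m' + c - m1.+1) m'.
    by congr (_ * qint q _ * _ + _); lia.
  by rewrite !qffact_small ?mulr0 //; lia.
have [b2|b2] := leqP m1.+1 (m' + c.+1); last first.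
  by rewrite mulr0 add0r ifF //; lia.
have -> : (m1 <= m' + c)%N by lia.
have -> : (m' + c.+1 - m1.+1 = 0)%N by lia.
have -> : (m' + c - m1 = 0)%N by lia.
by rewrite !qbin0 mulr0 add0r.
Qed.

End QAnalogues.

(** * Adding an element to a set partition *)

Section PartitionRecurrence.

Variables (T : finType) (D : {set T}) (y : T).
Hypothesis yD : y \notin D.

(** With [partition_shrink_block], this shows that putting y into a block B can be undone: {y} is
    not a block of the result, and the block of y gives B back. *)
Lemma partition_extend_block A B :
  partition A D -> B \in A ->
  [/\ partition ((y |: B) |: (A :\ B)) (y |: D),
      [set y] \notin (y |: B) |: (A :\ B), y \notin B,
      y |: B \notin A :\ B
    & pblock ((y |: B) |: (A :\ B)) y = y |: B].
Proof.
move=> pA BA; have /and3P[/eqP covA tA nA] := pA.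
have sub C : C \in A -> C \subset D by rewrite -covA; apply: bigcup_sup.
have yC C : C \in A -> y \notin C.
  by move=> CA; apply: contra yD; apply: (subsetP (sub C CA)).
have pA' := partitionD1 pA BA.
have nB : y |: B != set0 by apply/set0Pn; exists y; rewrite setU11.
have dis : [disjoint y |: B & D :\: B].
  rewrite -setI_eq0; apply/eqP/setP => x; rewrite !inE.
  by case: (eqVneq x y) => [->|_] /=; rewrite ?(negbTE yD) ?andbF //; case: (x \in B).
have pA1 := partitionU1 pA' nB dis.
have defD : (y |: B) :|: (D :\: B) = y |: D.
  by rewrite -setUA setUC setDE setUIr setUCr setIT (setUidPr (sub B BA)) setUC.
rewrite defD in pA1.
split=> //; last 1 first.
- by apply: def_pblock; rewrite ?setU11 //; case/and3P: pA1.
- rewrite !inE negb_or; apply/andP; split.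
    apply/eqP => /setP eqB; have /set0Pn[x xB] : B != set0.
      by apply: contraNneq nA => <-.
    by have := eqB x; rewrite !inE xB orbT => /eqP xy; move: (yC B BA); rewrite -xy xB.
  by rewrite negb_and negbK orbC; apply/orP; left; apply/negP => /yC; rewrite inE eqxx.
- exact: yC.
by rewrite !inE negb_and orbC; apply/orP; left; apply/negP => /yC; rewrite setU11.
Qed.

Lemma partition_shrink_block A (C := pblock A y) :
  partition A (y |: D) -> [set y] \notin A ->
  [/\ C \in A, y \in C, partition ((C :\ y) |: (A :\ C)) D
    & C :\ y \notin A :\ C].
Proof.
move=> pA y1A; have /and3P[/eqP covA tA nA] := pA.
have yA : y \in cover A by rewrite covA setU11.
have CA : C \in A by rewrite pblock_mem.
have yC : y \in C by rewrite mem_pblock.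
have CD : C \subset y |: D by rewrite -covA; apply: (bigcup_max C).
have pA' := partitionD1 pA CA.
have nC : C :\ y != set0.
  apply: contraNneq y1A => C0; rewrite -(_ : C = [set y]) //.
  by apply/eqP; rewrite -(setD1K yC) C0 setU0.
have dis : [disjoint C :\ y & (y |: D) :\: C].
  rewrite -setI_eq0; apply/eqP/setP => x; rewrite !inE.
  by case: (x \in C); rewrite /= ?andbF.
split=> //.
  have := partitionU1 pA' nC dis.
  suff -> : (C :\ y) :|: ((y |: D) :\: C) = D by [].
  apply/setP => x; rewrite !inE; have := subsetP CD x; rewrite !inE.
  case: (eqVneq x y) => [->|_] /=; first by rewrite yC (negbTE yD).
  by case: (x \in C) => //= ->.
rewrite !inE negb_and negbK orbC; apply/orP; left.
have /set0Pn[x xC'] := nC; have := xC'; rewrite 2!inE => /andP[xy xC].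
apply/negP => C'A; have := def_pblock tA C'A xC'.
rewrite (def_pblock tA CA xC) => eqC.
by move: yC; rewrite eqC !inE eqxx.
Qed.

(** In a partition of [y |: D], either {y} is a block, or deleting y leaves a partition of D with
    one marked block. *)
Lemma sum_partitionU1 (R : nmodType) (f : {set {set T}} -> R) :
  \sum_(A | partition A (y |: D)) f A =
  \sum_(A | partition A D)
     (f ([set y] |: A) + \sum_(B in A) f ((y |: B) |: (A :\ B))).
Proof.
rewrite big_split /= (bigID (fun A : {set {set T}} => [set y] \in A)) /=; congr (_ + _).
  rewrite (reindex_onto (fun A => [set y] |: A) (fun A => A :\ [set y])) /=; last first.
    by move=> A /andP[_ yA]; rewrite setD1K.
  apply: eq_bigl => A; rewrite setU11 andbT; apply/andP/idP.
    case=> pA /eqP eqA; have := partitionD1 pA (setU11 _ _).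
    by rewrite eqA setU1K.
  move=> pA; have yA : [set y] \notin A.
    apply: contra yD => yA; rewrite -(cover_partition pA).
    by apply/bigcupP; exists [set y] => //; rewrite inE.
  rewrite setU1K // eqxx; split=> //; apply: partitionU1 => //.
    by apply/set0Pn; exists y; rewrite inE.
  by rewrite disjoints1.
rewrite pair_big_dep /=.
rewrite (reindex_onto (fun p : {set {set T}} * {set T} => (y |: p.2) |: (p.1 :\ p.2))
  (fun A => ((pblock A y :\ y) |: (A :\ pblock A y), pblock A y :\ y))) /=; last first.
  move=> A /andP[pA y1A]; have [CA yC _ C'A] := partition_shrink_block pA y1A.
  by rewrite setD1K // setU1K // setD1K.
apply: eq_bigl => -[A B] /=; apply/andP/andP.
  case=> /andP[pA1 yA1] /eqP[eqA eqB].
  have [_ _] := partition_shrink_block pA1 yA1.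
  by rewrite eqA => ? _; split=> //; rewrite -eqA -[X in X \in _]eqB setU11.
case=> pA BA; have [pA1 yA1 yB BA' eqC] := partition_extend_block pA BA.
by rewrite pA1 yA1 eqC setU1K // setU1K // setD1K.
Qed.

End PartitionRecurrence.

Lemma card_ord_itv n a b : (b <= n)%N -> #|[set x : 'I_n | a <= x < b]%N| = (b - a)%N.
Proof.
move=> bn; rewrite cardsE -sum1_card -[RHS]muln1 -sum_nat_const_nat.
rewrite (big_nat_widen a b n) // big_geq_mkord.
by apply: eq_bigl => i; rewrite unfold_in /= andbC.
Qed.

(** * Block maxima and their ranks *)

Section Maxima.

Variable n : nat.
Implicit Types (A : {set {set 'I_n}}) (B D M : {set 'I_n}) (i j k x y : 'I_n).

Definition same_block A x y : bool := [exists B in A, (x \in B) && (y \in B)].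

Definition maxima A : {set 'I_n} :=
  [set i in cover A | [forall k, same_block A i k ==> (k <= i)%N]].

Lemma same_blockE A B x y :
  trivIset A -> B \in A -> x \in B -> same_block A x y = (y \in B).
Proof.
move=> tA BA xB; apply/existsP/idP => [[C /and3P[CA xC yC]]|yB].
  by rewrite -(def_pblock tA BA xB) (def_pblock tA CA xC).
by exists B; rewrite BA xB.
Qed.

Lemma same_blockC A x y : same_block A x y = same_block A y x.
Proof. by apply: eq_existsb => B; rewrite (andbC (x \in B)). Qed.

Lemma same_block_cover A x y : same_block A x y -> (x \in cover A) && (y \in cover A).
Proof.
case/existsP=> B /and3P[BA xB yB].
by apply/andP; split; apply/bigcupP; exists B.
Qed.

Lemma same_block_trans A x y k :
  trivIset A -> same_block A x y -> same_block A y k -> same_block A x k.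
Proof.
move=> tA /existsP[B /and3P[BA xB yB]].
by rewrite (same_blockE _ tA BA yB) (same_blockE _ tA BA xB).
Qed.

Lemma maximaE A B b :
  trivIset A -> B \in A -> b \in B ->
  (b \in maxima A) = [forall k in B, (k <= b)%N].
Proof.
move=> tA BA bB; rewrite inE; have -> /= : b \in cover A.
  by apply/bigcupP; exists B.
by apply: eq_forallb => k; rewrite (same_blockE _ tA BA bB).
Qed.

(** Each block is represented by its maximum, so choosing a block to join becomes choosing an
    element whose rank gives the weight. *)
Lemma sum_blocks_maxima (R : nmodType) A D (f : {set 'I_n} -> R) :
  partition A D ->
  \sum_(B in A) f B = \sum_(b in maxima A) f (pblock A b).
Proof.
case/and3P=> _ tA nA.
rewrite (partition_big (pblock A) (mem A)) /=; last first.
  by move=> b; rewrite inE => /andP[bA _]; rewrite pblock_mem.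
apply: eq_bigr => B BA.
have /set0Pn[x xB] : B != set0 by apply: contraNneq nA => <-.
pose b := [arg max_(y > x in B) val y]%N.
have [bB bmax] : b \in B /\ forall k, k \in B -> (k <= b)%N.
  by rewrite /b; case: arg_maxnP => //.
have bM : b \in maxima A.
  by rewrite (maximaE tA BA bB); apply/forall_inP.
rewrite (big_pred1 b) /= => [|k]; first by rewrite (def_pblock tA BA bB).
apply/andP/eqP => [[kM /eqP eqB] | ->]; last by rewrite bM (def_pblock tA BA bB).
have kB : k \in B by rewrite -eqB mem_pblock; move: kM; rewrite inE => /andP[].
rewrite (maximaE tA BA kB) in kM.
by apply/val_inj/anti_leq; rewrite bmax //= (forall_inP kM).
Qed.

Lemma card_maxima A D : partition A D -> #|maxima A| = #|A|.
Proof. by move/(sum_blocks_maxima (fun=> 1%N)); rewrite !sum1_card. Qed.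

Section Rank.

Variables (F : fieldType) (q : F).

(** The exponents are the ranks 0, ..., #|M| - 1 counted from the largest element; the induction
    removes the minimum, which has the top rank. *)
Lemma sum_rank M :
  \sum_(b in M) q ^+ #|[set i in M | b < i]%N| = qint q #|M|.
Proof.
have [k] := ubnP #|M|; elim: k M => // k IH M /ltnSE-Mk.
have [->|/set0Pn[x xM]] := eqVneq M set0.
  by rewrite big_set0 cards0 qint0.
pose b := [arg min_(y < x in M) val y]%N.
have [bM bmin] : b \in M /\ forall k, k \in M -> (b <= k)%N.
  by rewrite /b; case: arg_minnP => //.
rewrite (big_setD1 b) //= (cardsD1 b M) bM.
rewrite (_ : [set i in M | (b < i)%N] = M :\ b); last first.
  apply/setP => i; rewrite !inE andbC; case iM: (i \in M); rewrite ?andbF // !andbT.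
  by rewrite ltn_neqAle bmin // andbT eq_sym.
rewrite /qint add1n big_ord_recr /= addrC; congr (_ + _).
rewrite -[RHS]/(qint q _) -IH; last by move: Mk; rewrite (cardsD1 b M) bM add1n.
apply: eq_bigr => c; rewrite !inE => /andP[cb cM]; congr (_ ^+ #|pred_of_set _|).
apply/setP => i; rewrite !inE; case: (eqVneq i b) => [->|] //=.
by rewrite ltnNge bmin // andbF.
Qed.

(** The t positions just below N all lie in M and are its largest elements; dropping them leaves
    #|M| - t candidates, whose ranks are all shifted by t. *)
Lemma sum_rank_below M (N t : nat) :
  (N <= n)%N -> (t <= N)%N ->
  [set x : 'I_n | N - t <= x < N]%N \subset M ->
  (forall x, x \in M -> x < N)%N ->
  \sum_(b in M | (b + t < N)%N) q ^+ #|[set i in M | b < i]%N| =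
  q ^+ t * qint q (#|M| - t).
Proof.
set I := [set x | _]; move=> Nn tN IM MN.
have cI : #|I| = t by rewrite card_ord_itv // subKn.
pose M0 := [set b in M | (b + t < N)%N].
have MD : M0 = M :\: I.
  apply/setP => x; rewrite !inE andbC; case xM: (x \in M); rewrite ?andbF // !andbT.
  have := MN x xM; lia.
have -> : (#|M| - t)%N = #|M0| by rewrite MD cardsD (setIidPr IM) cI.
rewrite -sum_rank mulr_sumr; apply: eq_big => [b|b /andP[bM bt]].
  by rewrite inE.
rewrite -exprD; congr (_ ^+ _); rewrite -(cardsID I) addnC.
rewrite (_ : [set i in M | (b < i)%N] :&: I = I); last first.
  apply/setIidPr/subsetP => x xI; have := xI; rewrite !inE (subsetP IM x xI) /=; lia.
rewrite cI addnC; congr (_ + #|pred_of_set _|)%N.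
by rewrite MD; apply/setP => x; rewrite !inE andbA.
Qed.

End Rank.

End Maxima.

(** * Uncancelled squares of the board *)

Section Rooks.

Variable n : nat.
Implicit Types (A : {set {set 'I_n}}) (B D : {set 'I_n}) (i j k x y : 'I_n).

(** The rook of row i stands at the successor of i in its block, and that of column j at the
    predecessor of j. Being neither occupied nor cancelled is thus a condition on blocks alone. *)
Definition free_square A i j : bool :=
  [&& (i < j)%N, [forall k, same_block A i k ==> ~~ (i < k <= j)%N]
    & [forall k, same_block A j k ==> ~~ (i < k < j)%N]].

Definition column_weight A j : nat := #|[set i | free_square A i j]|.

Lemma in_rooks A i j : trivIset A ->
  ((i, j) \in rooks A) =
  [&& (i < j)%N, same_block A i j & [forall k, same_block A i k ==> ~~ (i < k < j)%N]].
Proof.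
move=> tA; rewrite !inE /=; congr (_ && _); apply/existsP/andP.
  case=> B /and4P[BA iB jB]; rewrite negb_exists => /forallP noB.
  rewrite !(same_blockE _ tA BA iB); split=> //; apply/forallP => k.
  by rewrite (same_blockE _ tA BA iB); move: (noB k); rewrite implybE -negb_and.
case=> /existsP[B /and3P[BA iB jB]] /forallP noB; exists B; rewrite BA iB jB /=.
rewrite negb_exists; apply/forallP => k.
by move: (noB k); rewrite (same_blockE _ tA BA iB) implybE -negb_and.
Qed.

Lemma free_squareE A i j : trivIset A ->
  free_square A i j =
  [&& (i < j)%N, (i, j) \notin rooks A & ~~ cancelled (rooks A) (i, j)].
Proof.
move=> tA; rewrite /free_square; case: ltnP => //= ij.
rewrite -negb_or; apply/idP/negP; last first.
  move=> noR; apply/andP; split; apply/forallP => k; apply/implyP => simk; apply/negP.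
    case/andP=> ik kj; case: noR.
    (* The minimal such l is the successor of i in its block; its rook occupies (i, j) or cancels it
       from the left. *)
    pose P := [pred l : 'I_n | same_block A i l && (i < l)%N].
    have Pk : P k by rewrite /= simk.
    case: (arg_minnP (fun l : 'I_n => val l) Pk) => l /andP[siml il] lmin.
    have rl : (i, l) \in rooks A.
      rewrite in_rooks // il siml /=; apply/forallP => z; apply/implyP => simz.
      apply/negP => /andP[iz zl]; have := lmin z; rewrite /= simz iz => /(_ isT); lia.
    have := lmin k Pk => /= lk.
    case: (ltngtP l j) => [lj|?|/val_inj <-]; [|lia|by rewrite rl].
    apply/orP; right; apply/existsP; exists (i, l); rewrite rl /= eqxx lj.
    by rewrite orbT.
  case/andP=> ik kj; case: noR.
  (* The maximal such l is the predecessor of j in its block; its rook stands above (i, j). *)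
  pose P := [pred l : 'I_n | same_block A j l && (i < l < j)%N].
  have Pk : P k by rewrite /= simk ik.
  case: (arg_maxnP (fun l : 'I_n => val l) Pk) => l /and3P[siml il lj] lmax.
  have rl : (l, j) \in rooks A.
    rewrite in_rooks // lj same_blockC siml /=; apply/forallP => z;
      apply/implyP => simz.
    apply/negP => /andP[lz zj]; have := lmax z.
    rewrite /= (same_block_trans tA siml simz) zj andbT => H.
    have /H /= : (i < z)%N by lia.
    lia.
  apply/orP; right; apply/existsP; exists (l, j); rewrite rl /= eqxx il.
  by [].
case/andP=> /forallP noi /forallP noj /orP[|].
  rewrite in_rooks // => /and3P[_ sij _].
  by have := noi j; rewrite sij ij leqnn.
case/existsP=> -[k l] /andP[]; rewrite in_rooks // => /and3P[kl skl _] /=.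
case/orP=> /andP[/eqP eq lt].
  have := noj k; rewrite same_blockC -eq in skl *; rewrite skl lt /=.
  by move: kl; rewrite -eq => ->.
by have := noi l; rewrite eq skl /= kl ltnW.
Qed.

Lemma rho_column_weight A :
  trivIset A -> rho A = (\sum_j column_weight A j)%N.
Proof.
move=> tA; rewrite /rho -sum1_card.
under [RHS]eq_bigr => j _ do rewrite /column_weight -sum1_card.
rewrite (exchange_big_dep xpredT) //= pair_big_dep /=.
apply: eq_bigl => -[i j]; rewrite !inE free_squareE //= !inE.
by [].
Qed.

End Rooks.

(** * Recurrence for separated set partitions *)

Section AddElement.

Variable n : nat.
Implicit Types (A : {set {set 'I_n}}) (B D : {set 'I_n}) (i j k x y : 'I_n).

Definition initial (N : nat) : {set 'I_n} := [set x : 'I_n | (x < N)%N].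

(* The [t y] elements just before [y] are those to be kept out of its block. *)
Definition separated (t : nat -> nat) A : bool :=
  [forall x, forall y, same_block A x y && (x < y)%N ==> (x + t y < y)%N].

(** For a partition of [initial N] only, the columns from N on could still contain free squares, so
    they are left out of [rho]. *)
Definition initial_weight (N : nat) A : nat :=
  (\sum_(j : 'I_n | (j < N)%N) column_weight A j)%N.

Lemma initialS y : initial y.+1 = y |: initial y.
Proof.
by apply/setP => x; rewrite !inE ltnS leq_eqVlt.
Qed.

Lemma initial_notin y : y \notin initial y.
Proof. by rewrite inE ltnn. Qed.

Variable y : 'I_n.

Lemma same_block_initial A x k :
  partition A (initial y) -> same_block A x k -> (x < y)%N && (k < y)%N.
Proof.
by move=> pA /same_block_cover; rewrite (cover_partition pA) !inE.
Qed.

Lemma same_block_set1U A x k :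
  same_block ([set y] |: A) x k = same_block A x k || ((x == y) && (k == y)).
Proof.
apply/existsP/orP => [[B] | [/existsP[B /andP[BA H]] | /andP[/eqP-> /eqP->]]].
- rewrite !inE => /andP[/orP[/eqP->|BA] H].
    by right; rewrite !inE in H.
  by left; apply/existsP; exists B; rewrite BA.
- by exists B; rewrite !inE BA orbT.
by exists [set y]; rewrite !inE !eqxx.
Qed.

Lemma same_block_joinU A B x k :
  partition A (initial y) -> B \in A ->
  same_block ((y |: B) |: (A :\ B)) x k =
  [|| same_block A x k, (x == y) && (k \in y |: B) | (k == y) && (x \in B)].
Proof.
move=> pA BA; have tA : trivIset A by case/and3P: pA.
apply/existsP/idP => [[C] | /or3P[/existsP[C /and3P[CA xC kC]] | /andP[/eqP-> kB] |
  /andP[/eqP-> xB]]].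
- rewrite 3!inE => /andP[/orP[/eqP->|/andP[_ CA]] /andP[xC kC]].
    move: xC; rewrite 2!inE => /orP[->|xB]; first by rewrite kC orbT.
    move: kC; rewrite 2!inE => /orP[->|kB]; first by rewrite xB !orbT.
    by rewrite (same_blockE _ tA BA xB) kB.
  by rewrite (same_blockE _ tA CA xC) kC.
- case: (eqVneq C B) => [eqC|CB].
    by exists (y |: B); rewrite setU11 -eqC !inE xC kC !orbT.
  by exists C; rewrite !inE CB CA xC kC orbT.
- by exists (y |: B); rewrite !setU11 kB.
by exists (y |: B); rewrite !setU11 !inE xB orbT.
Qed.

Section Extension.

Variables A A' : {set {set 'I_n}}.
Hypothesis AA' : forall x k,
  (x < y)%N -> (k < y)%N -> same_block A' x k = same_block A x k.

(** Whether a square of column j is free depends only on the block relation among elements up to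
    j. *)
Lemma column_weight_extend j : (j < y)%N -> column_weight A' j = column_weight A j.
Proof.
move=> jy; congr (#|pred_of_set _|); apply/setP => i; rewrite !inE /free_square.
case: ltnP => //= ij.
congr (_ && _); apply: eq_forallb => k.
  case kj: (i < k <= j)%N; rewrite ?implybT // AA' //; lia.
case kj: (i < k < j)%N; rewrite ?implybT // AA' //; lia.
Qed.

Lemma initial_weight_extend :
  initial_weight y.+1 A' = (initial_weight y A + column_weight A' y)%N.
Proof.
rewrite /initial_weight (bigD1 y) //= addnC; congr (_ + _)%N.
apply: eq_big => [j|j /andP[jy nj]].
  by rewrite ltnS [RHS]ltn_neqAle andbC.
by apply: column_weight_extend; rewrite ltn_neqAle nj -ltnS.
Qed.

End Extension.

(** When y is alone, column y has no rook, and its square in row i is cancelled exactly when i has a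
    successor in its block. *)
Lemma column_weight_set1U A :
  partition A (initial y) -> column_weight ([set y] |: A) y = #|A|.
Proof.
move=> pA; rewrite -(card_maxima pA); congr (#|pred_of_set _|); apply/setP => i.
rewrite [LHS]inE [RHS]inE (cover_partition pA) inE /free_square.
case: ltnP => //= iy; rewrite [X in _ && X](_ : _ = true) ?andbT.
  apply: eq_forallb => k; rewrite same_block_set1U (_ : (i == y) = false) ?orbF;
    last first.
    by apply/eqP => iy'; move: iy; rewrite iy' ltnn.
  case simk: (same_block A i k) => //=.
  by case/andP: (same_block_initial pA simk) => _ /ltnW ->; rewrite andbT -leqNgt.
apply/forallP => k; rewrite same_block_set1U eqxx /=; apply/implyP => /orP[sim|/eqP->].
  by have := same_block_initial pA sim; rewrite ltnn.
by rewrite ltnn andbF.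
Qed.

(** The new rook (b, y) cancels the rows below b, so among the rows of block maxima only those above
    b stay free. *)
Lemma column_weight_join A b :
  partition A (initial y) -> b \in maxima A ->
  column_weight ((y |: pblock A b) |: (A :\ pblock A b)) y =
  #|[set i in maxima A | (b < i)%N]|.
Proof.
move=> pA bM; have /and3P[_ tA _] := pA.
have bcov : b \in cover A by move: bM; rewrite inE => /andP[].
have BA := pblock_mem bcov; have bB : b \in pblock A b by rewrite mem_pblock.
set B := pblock A b in BA bB *.
have bmax : forall k, k \in B -> (k <= b)%N.
  by move=> k kB; move: bM; rewrite (maximaE tA BA bB) => /forall_inP; apply.
have By k : k \in B -> (k < y)%N.
  move=> kB; have : same_block A k b by rewrite (same_blockE _ tA BA kB).
  by case/(same_block_initial pA)/andP.
congr (#|pred_of_set _|); apply/setP => i.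
rewrite [LHS]inE [RHS]inE [i \in maxima A]inE (cover_partition pA) inE /free_square.
case: (ltnP i y) => //= iy.
have iy' : (i == y) = false by apply/eqP => e; move: iy; rewrite e ltnn.
apply/andP/andP => -[/forallP H1 H2].
  have iB : i \notin B.
    apply/negP => iB; have := H1 y.
    by rewrite same_block_joinU // eqxx iB /= !orbT iy leqnn.
  split.
    apply/forallP => k; apply/implyP => sim; have := H1 k.
    rewrite same_block_joinU // sim /=.
    by case/andP: (same_block_initial pA sim) => _ /ltnW ->; rewrite andbT -leqNgt.
  have := forallP H2 b; rewrite same_block_joinU // eqxx !inE bB /= orbT orbT /=.
  rewrite (By b bB) andbT -leqNgt leq_eqVlt => /orP[/eqP/val_inj eb|//].
  by move: iB; rewrite -eb bB.
split; apply/forallP => k; rewrite same_block_joinU //; apply/implyP;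
  rewrite ?iy' ?eqxx /=.
  case/orP=> [sim|/andP[/eqP-> iB]].
    have := H1 k; rewrite sim /=; lia.
  have := bmax i iB; lia.
case/or3P=> [sim|kB|/andP[/eqP-> _]]; last by rewrite ltnn andbF.
  by have := same_block_initial pA sim; rewrite ltnn.
move: kB; rewrite !inE => /orP[/eqP->|kB]; first by rewrite ltnn andbF.
have := bmax k kB; lia.
Qed.

Variable t : nat -> nat.
Hypothesis tS : forall l : nat, (t l.+1 <= (t l).+1)%N.
Hypothesis tle : forall l : nat, (t l <= l)%N.

Lemma separated_set1U A :
  partition A (initial y) -> separated t ([set y] |: A) = separated t A.
Proof.
move=> pA; apply: eq_forallb => x; apply: eq_forallb => k.
rewrite same_block_set1U; case: (same_block A x k) => //=.
by case: eqP => [->|//]; case: eqP => [->|//]; rewrite ltnn.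
Qed.

(** The new pairs (x, y) all have x <= b, so the constraint at b implies the others. *)
Lemma separated_join A b :
  partition A (initial y) -> b \in maxima A ->
  separated t ((y |: pblock A b) |: (A :\ pblock A b)) =
  separated t A && (b + t y < y)%N.
Proof.
move=> pA bM; have /and3P[_ tA _] := pA.
have bcov : b \in cover A by move: bM; rewrite inE => /andP[].
have BA := pblock_mem bcov; have bB : b \in pblock A b by rewrite mem_pblock.
set B := pblock A b in BA bB *.
have bmax : forall k, k \in B -> (k <= b)%N.
  by move=> k kB; move: bM; rewrite (maximaE tA BA bB) => /forall_inP; apply.
have By k : k \in B -> (k < y)%N.
  move=> kB; have : same_block A k b by rewrite (same_blockE _ tA BA kB).
  by case/(same_block_initial pA)/andP.
apply/forallP/andP => [H|[/forallP H Hb] x].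
  split.
    apply/forallP => x; apply/forallP => k; apply/implyP => /andP[sim lt].
    by have /forallP/(_ k) := H x; rewrite same_block_joinU // sim lt.
  by have /forallP/(_ y) := H b; rewrite same_block_joinU // eqxx bB !orbT (By b bB).
apply/forallP => k; apply/implyP;
  rewrite same_block_joinU // => /andP[/or3P[sim|/andP[/eqP-> kB]|/andP[/eqP-> xB]] lt].
- by have /forallP/(_ k) := H x; rewrite sim lt.
- move: kB lt; rewrite !inE => /orP[/eqP->|/By]; rewrite ?ltnn //; lia.
by have := bmax x xB; lia.
Qed.

(** If x had a later element k in its block, then x + t k < k. As t grows by at most 1 per step, k -
    t k <= y - t y, contradicting y - t y <= x. *)
Lemma separated_maxima A :
  partition A (initial y) -> separated t A ->
  [set x : 'I_n | y - t y <= x < y]%N \subset maxima A.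
Proof.
move=> pA /forallP sA; apply/subsetP => x; rewrite !inE => /andP[x1 xy].
rewrite (cover_partition pA) inE xy /=; apply/forallP => k; apply/implyP => sim.
rewrite leqNgt; apply/negP => xk.
have /forallP/(_ k) := sA x; rewrite sim xk /= => H.
have ky : (k < y)%N by case/andP: (same_block_initial pA sim).
have tmono d : (t (k + d) <= t k + d)%N.
  elim: d => [|d IH]; first by rewrite !addn0.
  have := tS (k + d)%N; rewrite !addnS; lia.
have := tmono (y - k)%N; rewrite subnKC; last exact: ltnW.
lia.
Qed.

Section Sums.

Variables (F : fieldType) (q : F).

Definition separated_sum (N m : nat) : F :=
  \sum_(A | [&& partition A (initial N), #|A| == m & separated t A])
     q ^+ initial_weight N A.

End Sums.

Variables (F : fieldType) (q : F).

Lemma separated_sumS m :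
  separated_sum q y.+1 m =
  separated_sum q y m * (q ^+ t y * qint q (m - t y))
  + (if m is m1.+1 then separated_sum q y m1 * q ^+ m1 else 0).
Proof.
(* The conditions on A become zero values of [f], since [sum_partitionU1] ranges over all
   partitions. *)
pose f N A : F :=
  if (#|A| == m) && separated t A then q ^+ initial_weight N A else 0.
have -> : separated_sum q y.+1 m = \sum_(A | partition A (initial y.+1)) f y.+1 A.
  rewrite /f -big_mkcondr; exact: eq_bigl.
rewrite initialS sum_partitionU1 ?initial_notin // big_split /= addrC.
have y1A A : partition A (initial y) -> [set y] \notin A.
  move=> pA; apply/negP => yA; have : y \in cover A.
    by apply/bigcupP; exists [set y]; rewrite ?inE.
  by rewrite (cover_partition pA) inE ltnn.
have ny x : (x < y)%N -> (x == y) = false.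
  by move=> xy; apply/eqP => e; rewrite e ltnn in xy.
congr (_ + _).
  rewrite /separated_sum mulr_suml.
  rewrite [RHS](eq_bigl (fun A =>
    partition A (initial y) && ((#|A| == m) && separated t A))) //.
  rewrite [RHS]big_mkcondr; apply: eq_bigr => A pA.
  have /and3P[_ tA _] := pA.
  rewrite (sum_blocks_maxima _ pA).
  transitivity (\sum_(b in maxima A)
     if [&& #|A| == m, separated t A & (b + t y < y)%N]
     then q ^+ initial_weight y A * q ^+ #|[set i in maxima A | (b < i)%N]| else 0).
    apply: eq_bigr => b bM; rewrite /f separated_join //.
    have bcov : b \in cover A by move: bM; rewrite inE => /andP[].
    have BA := pblock_mem bcov.
    have [pA1 _ _ nBA _] := partition_extend_block (initial_notin y) pA BA.
    have cA : #|(y |: pblock A b) |: (A :\ pblock A b)| = #|A|.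
      by rewrite cardsU1 nBA [in RHS](cardsD1 (pblock A b) A) BA.
    rewrite cA.
    rewrite (@initial_weight_extend A); last first.
      move=> x k xy ky; rewrite same_block_joinU // !ny //=.
      by rewrite orbF.
    by rewrite column_weight_join // exprD.
  case: (boolP (_ && _)) => [/andP[/eqP cA sA]|nAs]; last first.
    by apply: big1 => b _; rewrite andbA (negbTE nAs).
  under eq_bigr => b _ do rewrite cA eqxx sA /=.
  rewrite -big_mkcondr /= -mulr_sumr; congr (_ * _).
  (* By [separated_maxima], the forbidden blocks are those with the t y largest maxima. *)
  rewrite (sum_rank_below _ _ _ (separated_maxima pA sA)) ?(card_maxima pA) ?cA //.
    exact: ltnW.
  by move=> x; rewrite inE (cover_partition pA) inE => /andP[].
have fE A : partition A (initial y) -> f y.+1 ([set y] |: A) =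
  if (#|A|.+1 == m) && separated t A then q ^+ initial_weight y A * q ^+ #|A| else 0.
  move=> pA; rewrite /f cardsU1 y1A // add1n separated_set1U //.
  rewrite (@initial_weight_extend A); last first.
    by move=> x k xy ky; rewrite same_block_set1U !ny // orbF.
  by rewrite column_weight_set1U // exprD.
rewrite (eq_bigr _ fE); case: m {f fE} => [|m1].
  by apply: big1 => A _.
rewrite mulr_suml -big_mkcondr /=.
apply: eq_big => // A /and3P[_ /eqP[<-] _] //.
Qed.

(** Dividing by q^C(m,2) absorbs the weight q^m1 of opening a block, as C(m1+1,2) = C(m1,2) + m1;
    the recurrence then takes the shape of [strip_coefS]. *)
Definition normalized_sum (N m : nat) : F := separated_sum q N m / q ^+ 'C(m, 2).

Lemma normalized_sumS m : q != 0 ->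
  normalized_sum y.+1 m =
  q ^+ t y * qint q (m - t y) * normalized_sum y m
  + (if m is m1.+1 then normalized_sum y m1 else 0).
Proof.
move=> q0; rewrite /normalized_sum separated_sumS mulrDl; congr (_ + _); first by ring.
case: m => [|m1]; first by rewrite mul0r.
rewrite binS bin1 exprD; field.
by rewrite !expf_neq0.
Qed.

End AddElement.

(** * The rook side *)

(** Position of y inside its block of [A_nu], hence the number of preceding elements it must avoid;
    0 beyond the last block. *)
Fixpoint offset (nu : seq nat) (y : nat) : nat :=
  if nu is c :: nu' then if (y < c)%N then y else offset nu' (y - c) else 0%N.

Lemma offset_le nu y : (offset nu y <= y)%N.
Proof.
elim: nu y => //= c nu IH y; case: ltnP => // _.
exact: leq_trans (IH _) (leq_subr _ _).
Qed.

Lemma offsetS nu y : (offset nu y.+1 <= (offset nu y).+1)%N.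
Proof.
elim: nu y => //= c nu IH y; case: ltnP => [lt1|ge1]; first by rewrite (ltnW lt1).
case: ltnP => [lt2|ge2]; last by rewrite subSn //; apply: IH.
have -> : (y.+1 - c = 0)%N by lia.
by have := offset_le nu 0; lia.
Qed.

Lemma sumn_take_next nu i :
  (i < size nu)%N -> sumn (take i.+1 nu) = (sumn (take i nu) + nth 0 nu i)%N.
Proof. by move=> lti; rewrite (take_nth 0%N) // sumn_rcons. Qed.

Lemma offset_take nu i y :
  (sumn (take i nu) <= y < sumn (take i.+1 nu))%N ->
  offset nu y = (y - sumn (take i nu))%N.
Proof.
elim: nu i y => [|c nu IH] [|i] y /=; rewrite ?take0 ?addn0 ?subn0 //.
- by move=> ->.
have [yc|cy] := ltnP y c => le; first by lia.
by rewrite (IH i) ?subnDA //=; lia.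
Qed.

Lemma take_interval nu y : (y < sumn nu)%N ->
  exists2 i, (i < size nu)%N & (sumn (take i nu) <= y < sumn (take i.+1 nu))%N.
Proof.
elim: nu y => //= c nu IH y lt; have [yc|cy] := ltnP y c.
  by exists 0%N => //; rewrite ?take0 ?addn0.
have [|i lti le] := IH (y - c)%N; first lia.
by exists i.+1 => //=; lia.
Qed.

(** The blocks of [A_nu] are intervals: x < y lie in the same one exactly when y <= x +
    [offset nu y]. *)
Lemma separated_A_nu n nu (A : {set {set 'I_n}}) :
  sumn nu = n ->
  [forall B in A, forall C in A_nu n nu, (#|B :&: C| <= 1)%N] =
  separated (offset nu) A.
Proof.
move=> nun; apply/forall_inP/forallP => [H x|H B BA].
  apply/forallP => y; apply/implyP => /andP[/existsP[B /and3P[BA xB yB]] xy].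
  have [|i lti yi] := @take_interval nu y; first by rewrite nun.
  rewrite (offset_take yi) ltnNge; apply/negP => yx.
  have CA : nu_block n nu i \in A_nu n nu by apply/imsetP; exists (Ordinal lti).
  have /forall_inP/(_ _ CA)/card_le1_eqP/(_ x y) := H B BA.
  rewrite !inE xB yB yi /= => /(_ _ isT) E.
  have /E xy' : (sumn (take i nu) <= x < sumn (take i.+1 nu))%N by lia.
  by rewrite xy' ltnn in xy.
apply/forall_inP => _ /imsetP[i _ ->]; apply/card_le1_eqP.
suff W x y : x \in B :&: nu_block n nu i -> y \in B :&: nu_block n nu i -> ~ (x < y)%N.
  move=> x y xC yC; apply/val_inj/eqP.
  by case: ltngtP => // lt; [case: (W y x yC xC lt) | case: (W x y xC yC lt)].
rewrite !inE => /andP[xB xi] /andP[yB yi] xy.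
have /forallP/(_ y) := H x;
  rewrite xy andbT (_ : same_block A x y) ?(offset_take yi) /=.
  lia.
by apply/existsP; exists B; rewrite BA xB.
Qed.

Section Rooks.

Variables (n : nat) (F : fieldType) (q : F).
Hypothesis q0 : q != 0.

Lemma normalized_sum0 t m : normalized_sum n t q 0 m = (m == 0)%:R.
Proof.
rewrite /normalized_sum /separated_sum.
have I0 : initial n 0 = set0 by apply/setP => x; rewrite !inE.
have W0 A : initial_weight 0 A = 0%N by rewrite /initial_weight big_pred0.
case: m => [|m].
  rewrite divr1 (big_pred1 set0) ?W0 // => A /=.
  rewrite I0 partition_set0 cards_eq0; case: eqP => //= ->.
  apply/forallP => x; apply/forallP => y; apply/implyP => /andP[/existsP[B]].
  by rewrite inE.
rewrite big_pred0 ?mul0r // => A; rewrite I0 partition_set0.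
by case: eqP => //= ->; rewrite cards0.
Qed.

(** Along a block of size c starting at N the offsets are 0, ..., c - 1, so iterating
    [normalized_sumS] follows the recurrence [strip_coefS]. *)
Lemma normalized_sum_strip t c N m :
  (forall l, t l.+1 <= (t l).+1)%N -> (forall l, t l <= l)%N ->
  (forall j, j < c -> t (N + j) = j)%N -> (N + c <= n)%N -> (m <= n)%N ->
  normalized_sum n t q (N + c) m =
  \sum_(m' < n.+1) normalized_sum n t q N m' * strip_coef q c m' m.
Proof.
move=> tS tle; elim: c m => [|c IH] m tN Nn mn.
  rewrite addn0 (bigD1 (inord m)) //= strip_coef0 inordK ?ltnS // eqxx mulr1.
  rewrite big1 ?addr0 // => i im; rewrite strip_coef0 [_ == _](_ : _ = false) ?mulr0 //.
  by apply: contraNF im => /eqP <-; rewrite inord_val.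
have ltN : (N + c < n)%N by rewrite -addnS.
rewrite addnS (@normalized_sumS _ (Ordinal ltN) t) //= tN //.
have tN' j : (j < c)%N -> t (N + j)%N = j by move=> jc; rewrite tN // ltnS ltnW.
rewrite IH //; last exact: ltnW.
under [RHS]eq_bigr => m' _ do rewrite strip_coefS mulrDr.
rewrite big_split /=; congr (_ + _).
  by rewrite mulr_sumr; apply: eq_bigr => m' _; ring.
case: m mn => [|m1] mn; first by rewrite big1 // => m' _; rewrite mulr0.
by rewrite IH // ltnW.
Qed.

Lemma St_q_normalized_sum m nu :
  sumn nu = n -> St_q q n m nu = normalized_sum n (offset nu) q n m.
Proof.
move=> nun; rewrite /St_q /normalized_sum /separated_sum mulr_suml.
have In : initial n n = [set: 'I_n] by apply/setP => x; rewrite !inE ltn_ord.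
apply: eq_big => [A|A /and3P[/and3P[_ tA _] _ _]].
  by rewrite In separated_A_nu.
rewrite expfzDr // -exprnP; congr (q ^+ _ * _).
  rewrite rho_column_weight // /initial_weight; apply: eq_bigl => j.
  by rewrite ltn_ord.
by rewrite -exprnN.
Qed.

End Rooks.

(** * Sums over horizontal strips *)

Lemma bin2D a b : 'C(a + b, 2) = ('C(a, 2) + 'C(b, 2) + a * b)%N.
Proof.
elim: b => [|b IH]; first by rewrite bin0n !addn0 muln0 addn0.
by rewrite addnS !binS !bin1 IH; lia.
Qed.

(** The intervals [f (i+1), f i) tile [f k, f 0); they are taken from left to right, as [op] need
    not commute. *)
Lemma big_telescope_itv (R : Type) (idx : R) (op : Monoid.law idx) (f : nat -> nat)
    (g : nat -> R) k :
  (forall i, i < k -> f i.+1 <= f i)%N ->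
  \big[op/idx]_(f k <= s < f 0%N) g s =
  \big[op/idx]_(i < k) \big[op/idx]_(f (k - i)%N <= s < f (k - i.+1)%N) g s.
Proof.
elim: k => [|k IH] mono; first by rewrite big_ord0 big_geq.
have le0 j : (j <= k)%N -> (f k <= f j)%N.
  move=> jk; rewrite -(subKn jk); elim: (k - j)%N (leq_subr j k) => [|d IHd] dk.
    by rewrite subn0.
  apply: leq_trans (IHd (ltnW dk)) _.
  have -> : (k - d = (k - d.+1).+1)%N by lia.
  by apply: mono; lia.
rewrite (big_cat_nat (n := f k)) /=; [|exact: mono|exact: le0].
rewrite IH; last by move=> i ik; apply: mono; rewrite ltnW.
rewrite big_ord_recl /= subn0 subSS subn0; congr (op _ _).
Qed.

Section StripSums.

Variables (n : nat) (F : fieldType) (q : F).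

(** Row lengths padded with zeros. With n + 1 rows, a nonincreasing diagram of size at most n has an
    empty last row ([last_row0]), so the tiling by rows reaches 0. *)
Definition diagram : predArgType := {ffun 'I_n.+1 -> 'I_n.+1}.

Implicit Types (v : diagram).

(** [prow] and [srow] embed j as j and j + 1; they serve both for consecutive rows and for
    consecutive diagrams of a path. *)
Definition prow (j : 'I_n) : 'I_n.+1 := widen_ord (leqnSn n) j.
Definition srow (j : 'I_n) : 'I_n.+1 := lift ord0 j.

Definition shape_size v : nat := (\sum_i v i)%N.

Definition shape_exp v : nat := (\sum_(j < n) 'C(v (srow j), 2))%N.

Definition nonincreasing v : bool := [forall j, v (srow j) <= v (prow j)]%N.

Definition extends c v' v : bool :=
  [forall i, v' i <= v i]%N && (shape_size v == shape_size v' + c)%N.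

(** With b0 new cells in the first row, the first factor stands for [c]!/[b0]!. For nonincreasing
    v', the binomials vanish unless each new row fits under the old row above it, so only horizontal
    strips contribute. *)
Definition strip_weight c v' v : F :=
  if extends c v' v then
    qffact q c (c - (v ord0 - v' ord0))
    * \prod_j qbin q (v' (prow j) - v' (srow j)) (v (srow j) - v' (srow j))
  else 0.

(** For b = x - a new cells, C(x,2) = C(a,2) + C(b,2) + a b, and the q-binomial theorem applies at y
    = q^a. The bound on a + d lets every b <= d occur. *)
Lemma strip_row_poly a d : (a + d <= n)%N ->
  \sum_(x < n.+1)
     (if (a <= x)%N then q ^+ 'C(x, 2) * qbin q d (x - a) else 0) *: 'X^(x - a) =
  q ^+ 'C(a, 2) *: \prod_(t < d) (1 + (q ^+ (a + t)) *: 'X).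
Proof.
move=> adn.
under [X in _ = _ *: X]eq_bigr => t _ do rewrite exprD.
rewrite qbinomial_theorem scaler_sumr.
rewrite (bigID (fun x : 'I_n.+1 => (a <= x)%N)) /= [X in _ + X]big1 ?addr0; last first.
  by move=> x /negbTE ->; rewrite scale0r.
rewrite (eq_bigr (fun x : 'I_n.+1 =>
  (q ^+ 'C(x, 2) * qbin q d (x - a)) *: 'X^(x - a))); last first.
  by move=> x ->.
rewrite -(@big_geq_mkord _ _ _ a n.+1 xpredT
  (fun x => (q ^+ 'C(x, 2) * qbin q d (x - a)) *: 'X^(x - a))).
rewrite -{1}(add0n a) big_addn big_mkord (big_ord_widen_cond (n.+1 - a) xpredT
  (fun b => q ^+ 'C(a, 2) *: ((q ^+ 'C(b,
    2) * qbin q d b * (q ^+ a) ^+ b) *: 'X^b))); last lia.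
rewrite [RHS]big_mkcond; apply: eq_bigr => b _ /=; rewrite addnK.
case: ltnP => [bd|db]; last by rewrite qbin_small // mulr0 scale0r.
rewrite scalerA addnC bin2D !exprD -exprM; congr (_ *: _); ring.
Qed.

(** Row j + 1 yields the factors 1 + q^s X for s between its length and that of row j. As the last
    row is empty, these intervals tile [0, v 0). *)
Lemma strips_poly v : nonincreasing v -> v ord_max = ord0 ->
  \prod_(j < n) \sum_(x < n.+1)
     (if (v (srow j) <= x)%N
      then q ^+ 'C(x, 2) * qbin q (v (prow j) - v (srow j)) (x - v (srow j)) else 0)
       *: 'X^(x - v (srow j)) =
  q ^+ shape_exp v *: \prod_(s < v ord0) (1 + (q ^+ s) *: 'X).
Proof.
move=> /forallP dec vmax.
under eq_bigr => j _.
  rewrite strip_row_poly; last first.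
    by have := dec j; have := ltn_ord (v (prow j)); lia.
  over.
rewrite scaler_prod /shape_exp -expr_sum; congr (_ *: _).
pose f i := val (v (inord i)).
have fp (j : 'I_n) : f j = v (prow j).
  by rewrite /f; congr (val (v _)); apply: val_inj; rewrite /= inordK // ltnS ltnW.
have fs (j : 'I_n) : f j.+1 = v (srow j).
  by rewrite /f; congr (val (v _)); apply: val_inj; rewrite /= inordK // ltnS.
have f0 : f 0%N = v ord0.
  by rewrite /f; congr (val (v _)); apply: val_inj; rewrite /= inordK.
have fn : f n = 0%N.
  by rewrite /f (_ : inord n = ord_max) ?vmax //; apply: val_inj; rewrite /= inordK.
rewrite -(big_mkord xpredT (fun s => 1 + q ^+ s *: 'X)) -[in RHS]fn -f0.
rewrite big_telescope_itv; last first.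
  by move=> i ltin; have := dec (Ordinal ltin); rewrite -fs -fp.
rewrite [RHS](reindex_inj rev_ord_inj) /=; apply: eq_bigr => j _.
have -> : (n - (n - j.+1) = j.+1)%N by have := ltn_ord j; lia.
have -> : (n - (n - j.+1).+1 = j)%N by have := ltn_ord j; lia.
rewrite -fs -fp -[in RHS](add0n (f j.+1)) big_addn big_mkord.
by apply: eq_bigr => t _; rewrite addnC.
Qed.

(** The strip has r = v' 0 + c - m cells outside the first row, so the sum is the coefficient of X^r
    in [strips_poly], up to a factor fixed by c and r. *)
Lemma sum_strips c v' m : nonincreasing v' -> v' ord_max = ord0 -> (m <= n)%N ->
  \sum_(v : diagram | v ord0 == m :> nat) strip_weight c v' v * q ^+ shape_exp v =
  q ^+ shape_exp v' * strip_coef q c (v' ord0) m.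
Proof.
move=> dec vmax mn; rewrite /strip_coef.
have split_size v : shape_size v = (v ord0 + \sum_(j < n) v (srow j))%N.
  by rewrite /shape_size big_ord_recl.
case: ifP => [/andP[lem lemc]|out]; last first.
  rewrite mulr0; apply: big1 => v /eqP vm; rewrite /strip_weight /extends.
  case: ifP => [/andP[/forallP le /eqP sz]|]; last by rewrite mul0r.
  move: sz out; rewrite !split_size -vm le /= => sz.
  have : (\sum_(j < n) v' (srow j) <= \sum_(j < n) v (srow j))%N.
    by apply: leq_sum => j _; apply: le.
  move=> ge out; exfalso; move: ge sz out.
  by move: (\sum_(j < n) v' _)%N (\sum_(j < n) v _)%N => S1 S2; lia.
set r := (_ + c - m)%N.
have := congr1 (fun p : {poly F} => p`_r) (strips_poly dec vmax).
have -> : \prod_(s < v' ord0) (1 + q ^+ s *: 'X) =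
   \prod_(s < v' ord0) (1 + (1 * q ^+ s) *: 'X).
  by apply: eq_bigr => s _; rewrite mul1r.
rewrite qbinomial_theorem coefZ coef_sum.
have -> : \sum_(b < (v' ord0).+1)
    ((q ^+ 'C(b, 2) * qbin q (v' ord0) b * 1 ^+ b) *: 'X^b : {poly F})`_r =
    q ^+ 'C(r, 2) * qbin q (v' ord0) r.
  have [rv|vr] := ltnP r (v' ord0).+1.
    rewrite (bigD1 (Ordinal rv)) //= coefZ coefXn eqxx expr1n !mulr1.
    rewrite big1 ?addr0 // => b /eqP br; rewrite coefZ coefXn.
    by case: eqP => [rb|]; rewrite ?mulr0 //; case: br; apply: val_inj.
  rewrite qbin_small // mulr0 big1 // => b _; rewrite coefZ coefXn.
  by case: eqP => [rb|]; rewrite ?mulr0 //; have := ltn_ord b; rewrite -rb ltnNge vr.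
move=> eqr.
rewrite qffact_qbin.
transitivity (qffact q c r * (q ^+ shape_exp v' * (q ^+ 'C(r,
  2) * qbin q (v' ord0) r))); last first.
  by rewrite qffact_qbin; ring.
rewrite -{}eqr.
(* Row 0 receives a factor forcing its length to be m, so that the product over all rows expands
   into a sum over diagrams. *)
pose G (i x : 'I_n.+1) : {poly F} :=
  if unlift ord0 i is Some j then
    (if (v' (srow j) <= x)%N
      then q ^+ 'C(x, 2) * qbin q (v' (prow j) - v' (srow j)) (x - v' (srow j)) else 0)
       *: 'X^(x - v' (srow j))
  else (x == m :> nat)%:R.
have -> : \prod_(j < n) \sum_(x < n.+1)
     (if (v' (srow j) <= x)%N
      then q ^+ 'C(x, 2) * qbin q (v' (prow j) - v' (srow j)) (x - v' (srow j)) else 0)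
       *: 'X^(x - v' (srow j)) = \prod_i \sum_x G i x.
  rewrite [RHS]big_ord_recl [X in X * _](_ : _ = 1) ?mul1r; last first.
    rewrite /G unlift_none (bigD1 (inord m)) //= inordK // eqxx big1 ?addr0 // => x.
    by move=> xm; case: eqP => // xm'; case/eqP: xm; rewrite -xm' inord_val.
  by apply: eq_bigr => j _; rewrite /G liftK.
rewrite bigA_distr_bigA coef_sum mulr_sumr big_mkcond /=.
apply: eq_bigr => v _; rewrite big_ord_recl {1}/G unlift_none.
case: eqP => [vm|]; last by rewrite mul0r coef0 mulr0.
rewrite mul1r.
under eq_bigr => j _ do rewrite /G liftK -/(srow j).
rewrite scaler_prod -expr_sum coefZ coefXn /strip_weight /extends.
case: (boolP [forall i, v' i <= v i]%N) => /= [/forallP le|nle]; last first.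
  rewrite mul0r; suff [j lj] : exists j, ~~ (v' (srow j) <= v (srow j))%N.
    by rewrite (bigD1 j) //= (negbTE lj) !mul0r mulr0.
  case/forallPn: nle => i; case: (unliftP ord0 i) => [j ->|-> ]; first by exists j.
  by rewrite vm lem.
rewrite [X in _ = _ * (X * _)](eq_bigr (fun j => q ^+ 'C(v (srow j), 2) *
   qbin q (v' (prow j) - v' (srow j)) (v (srow j) - v' (srow j)))); last first.
  by move=> j _; rewrite (le (srow j)).
(* The exponent of X counts the new cells outside the first row; it is r exactly when the size grows
   by c. *)
rewrite (_ : (r == _) = (shape_size v == shape_size v' + c)%N); last first.
  rewrite !split_size vm /r.
  have E : (\sum_(j < n) v (srow j) =
    \sum_(j < n) (v (srow j) - v' (srow j)) + \sum_(j < n) v' (srow j))%N.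
    by rewrite -big_split /=; apply: eq_bigr => j _; rewrite subnK // le.
  rewrite {}E; move: (\sum_(j < n) (v _ - v' _))%N (\sum_(j < n) v' _)%N => S1 S2;
    apply/eqP/eqP; lia.
case: eqP => _; last by rewrite mul0r !mulr0.
have -> : (c - (v ord0 - v' ord0) = r)%N by rewrite vm /r; lia.
by rewrite big_split /= /shape_exp expr_sum; ring.
Qed.

End StripSums.

(** * Sequences of diagrams *)

Section PathSums.

Variables (V : finType) (F : fieldType) (W : nat -> V -> V -> F).

Definition path_weight l (L : {ffun 'I_l.+1 -> V}) : F :=
  \prod_(k < l) W k (L (prow k)) (L (srow k)).

Definition extend_path l (L : {ffun 'I_l.+1 -> V}) (v : V) : {ffun 'I_l.+2 -> V} :=
  [ffun i => if unlift ord_max i is Some j then L j else v].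

Lemma extend_path_lift l (L : {ffun 'I_l.+1 -> V}) v (j : 'I_l.+1) (i : 'I_l.+2) :
  val i = val j -> extend_path L v i = L j.
Proof.
by move=> ij; rewrite ffunE (_ : i = lift ord_max j) ?liftK //; apply/val_inj;
  rewrite [RHS]lift_max.
Qed.

Lemma extend_path_max l (L : {ffun 'I_l.+1 -> V}) v : extend_path L v ord_max = v.
Proof. by rewrite ffunE unlift_none. Qed.

Lemma path_weight_extend l (L : {ffun 'I_l.+1 -> V}) v :
  path_weight (extend_path L v) = path_weight L * W l (L ord_max) v.
Proof.
rewrite /path_weight big_ord_recr /=; congr (_ * W _ _ _).
- by apply: eq_bigr => k _; congr (W _ _ _); apply: extend_path_lift.
- exact: extend_path_lift.
by rewrite -[RHS](extend_path_max L v); congr (extend_path _ _ _); apply: val_inj.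
Qed.

Lemma sum_paths_last l v0 (g : V -> F) :
  \sum_(L : {ffun 'I_l.+2 -> V} | L ord0 == v0) path_weight L * g (L ord_max) =
  \sum_(L : {ffun 'I_l.+1 -> V} | L ord0 == v0)
    path_weight L * \sum_v W l (L ord_max) v * g v.
Proof.
under [RHS]eq_bigr => L _ do rewrite mulr_sumr.
rewrite pair_big /=.
rewrite (reindex (fun p : {ffun 'I_l.+1 -> V} * V => extend_path p.1 p.2)) /=.
  apply: eq_big => [[L v]|[L v] _] /=.
    by rewrite andbT (@extend_path_lift _ L v ord0 ord0).
  by rewrite path_weight_extend extend_path_max mulrA.
exists (fun L => ([ffun j => L (lift ord_max j)], L ord_max)) => [[L v] _|L _] /=.
  rewrite extend_path_max; congr (_, _); apply/ffunP => j.
  by rewrite ffunE; apply: extend_path_lift; apply: lift_max.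
apply/ffunP => i; rewrite ffunE.
by case: unliftP => [j ->|-> //]; rewrite ffunE.
Qed.

End PathSums.

(** * Chains of horizontal strips, sorted by the length of the first row *)

Section StripPaths.

Variables (n : nat) (F : fieldType) (q : F) (nu : seq nat).

Local Notation diagram := (diagram n).
Local Notation strip_path_weight :=
  (path_weight (fun k => @strip_weight n F q (nth 0%N nu k))).

Definition empty_shape : diagram := [ffun=> ord0].

Definition first_row_sum (l m : nat) : F :=
  \sum_(L : {ffun 'I_l.+1 -> diagram} | L ord0 == empty_shape)
    strip_path_weight L *
    (if L ord_max ord0 == m :> nat then q ^+ shape_exp (L ord_max) else 0).

Lemma strip_weight_neq0 c (v' v : diagram) : strip_weight q c v' v != 0 ->
  extends c v' v /\
  forall j, (v (srow j) - v' (srow j) <= v' (prow j) - v' (srow j))%N.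
Proof.
rewrite /strip_weight; case: ifP => [ext|]; last by rewrite eqxx.
rewrite mulf_eq0 negb_or => /andP[_ /prodf_neq0 nz]; split=> // j.
by rewrite leqNgt; apply/negP => lt; have := nz j isT; rewrite qbin_small ?eqxx.
Qed.

Lemma strip_nonincreasing c (v' v : diagram) :
  strip_weight q c v' v != 0 -> nonincreasing v' ->
  nonincreasing v /\ forall j, (v (srow j) <= v' (prow j))%N.
Proof.
case/strip_weight_neq0 => /andP[/forallP le _] int /forallP dec.
have int' j : (v (srow j) <= v' (prow j))%N.
  have := int j; have := dec j; have := le (srow j); lia.
by split=> //; apply/forallP => j; apply: leq_trans (int' j) (le _).
Qed.

(** A nonzero weight makes every step a horizontal strip, so partitions stay partitions; sums may
    therefore range over all sequences of diagrams. *)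
Lemma strip_path_shapes l (L : {ffun 'I_l.+1 -> diagram}) (k : 'I_l.+1) :
  (l <= size nu)%N -> L ord0 = empty_shape -> strip_path_weight L != 0 ->
  nonincreasing (L k) /\ shape_size (L k) = sumn (take k nu).
Proof.
move=> lnu L0 /prodf_neq0 nz; case: k => k; elim: k => [|k IH] kl.
  rewrite (_ : Ordinal kl = ord0); last exact: val_inj.
  rewrite L0 take0; split; first by apply/forallP => j; rewrite !ffunE.
  by rewrite /shape_size big1 // => i _; rewrite ffunE.
have kl' : (k < l)%N by rewrite -ltnS.
have [dec sz] := IH (ltnW kl).
have Ep : prow (Ordinal kl') = Ordinal (ltnW kl) by apply: val_inj.
have Es : srow (Ordinal kl') = Ordinal kl by apply: val_inj.
have := nz (Ordinal kl') isT; rewrite Ep Es /= => nzk.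
have [/andP[_ /eqP ->] _] := strip_weight_neq0 nzk.
split; first by case: (strip_nonincreasing nzk dec).
by rewrite sz sumn_take_next // (leq_trans kl').
Qed.

Lemma sumn_take_le k : (sumn (take k nu) <= sumn nu)%N.
Proof. by rewrite -{2}(cat_take_drop k nu) sumn_cat leq_addr. Qed.

Lemma nonincreasing_le (v : diagram) (i j : 'I_n.+1) :
  nonincreasing v -> (i <= j)%N -> (v j <= v i)%N.
Proof.
move=> /forallP dec; case: i j => i lti [j ltj] /= ij.
elim: j ltj ij => [|j IH] ltj ij.
  by rewrite (_ : Ordinal ltj = Ordinal lti) //; apply: val_inj => /=; lia.
move: ij; rewrite leq_eqVlt => /orP[/eqP eq|ij].
  by rewrite (_ : Ordinal ltj = Ordinal lti) //; apply: val_inj.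
have ltj' : (j < n)%N by rewrite -ltnS.
have := dec (Ordinal ltj').
have -> : prow (Ordinal ltj') = Ordinal (ltnW ltj) by apply: val_inj.
have -> : srow (Ordinal ltj') = Ordinal ltj by apply: val_inj.
move=> H; exact: leq_trans H (IH _ _).
Qed.

Lemma last_row0 (v : diagram) :
  nonincreasing v -> (shape_size v <= n)%N -> v ord_max = ord0.
Proof.
move=> dec sz; apply: val_inj => /=; apply/eqP; rewrite -leqn0 leqNgt;
  apply/negP => pos.
suff : (n.+1 <= shape_size v)%N by rewrite ltnNge sz.
rewrite -[X in (X <= _)%N]card_ord -sum1_card /shape_size; apply: leq_sum => i _.
by apply: leq_trans pos _; apply: nonincreasing_le; rewrite // -ltnS.
Qed.

Lemma first_row_sum0 m : first_row_sum 0 m = (m == 0)%:R.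
Proof.
rewrite /first_row_sum (big_pred1 [ffun=> empty_shape]) => [|L /=]; last first.
  apply/eqP/eqP => [L0|->]; last by rewrite ffunE.
  by apply/ffunP => i; rewrite ffunE (ord1 i).
rewrite /path_weight big_ord0 mul1r !ffunE /= eq_sym; case: eqP => // _.
by rewrite /shape_exp big1 // => j _; rewrite !ffunE bin0n.
Qed.

(** By [sum_strips], the sum over the last strip sees only the first row m' of the preceding
    diagram, by which the paths are grouped. *)
Lemma first_row_sumS l m : sumn nu = n -> (l < size nu)%N -> (m <= n)%N ->
  first_row_sum l.+1 m =
  \sum_(m' < n.+1) first_row_sum l m' * strip_coef q (nth 0%N nu l) m' m.
Proof.
move=> nun lnu mn; rewrite /first_row_sum.
rewrite (@sum_paths_last _ _ _ _ _
  (fun v : diagram => if v ord0 == m :> nat then q ^+ shape_exp v else 0)).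
under [RHS]eq_bigr => m' _ do rewrite mulr_suml.
rewrite exchange_big /=; apply: eq_bigr => L /eqP L0.
under [RHS]eq_bigr => m' _ do rewrite -mulrA.
rewrite -mulr_sumr.
(* Only paths of nonzero weight are known to end in a partition, as [sum_strips] requires. *)
have [->|nz] := eqVneq (strip_path_weight L) 0; first by rewrite !mul0r.
have [dec sz] := strip_path_shapes ord_max (ltnW lnu) L0 nz.
congr (_ * _).
transitivity (\sum_(v : diagram | v ord0 == m :> nat)
    strip_weight q (nth 0%N nu l) (L ord_max) v * q ^+ shape_exp v).
  by rewrite [RHS]big_mkcond; apply: eq_bigr => v _; case: ifP; rewrite ?mulr0.
rewrite sum_strips //; last first.
  by apply: last_row0 => //; rewrite sz -nun sumn_take_le.
rewrite (bigD1 (L ord_max ord0)) //= eqxx big1 ?addr0 // => m' /eqP nm.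
by case: eqP => [e|]; rewrite ?mul0r //; case: nm; apply: val_inj.
Qed.

End StripPaths.

(** * Tableaux as sequences of diagrams *)

Section Cells.

Variable mu : seq nat.

Lemma big_cells (R : Type) (idx : R) (op : Monoid.com_law idx)
    (A : pred nat) (B : nat -> pred nat) (f : nat -> nat -> R) :
  \big[op/idx]_(c : cell mu | A (crow c) && B (crow c) (ccol c)) f (crow c) (ccol c) =
  \big[op/idx]_(i < size mu | A i) \big[op/idx]_(j < nth 0%N mu i | B i j) f i j.
Proof.
by rewrite (@sig_big_dep _ _ op _ (fun i : 'I_(size mu) => 'I_(nth 0%N mu i))
  (fun i => A i) (fun i j => B i j) (fun i j => f i j)).
Qed.

Lemma card_cells_row i a :
  #|[set c : cell mu | (crow c == i) && (ccol c < a)%N]| = minn a (nth 0%N mu i).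
Proof.
rewrite cardsE -sum1_card.
rewrite (big_cells _ (pred1 i) (fun _ j => j < a)%N (fun _ _ => 1%N)).
have [lti|lei] := ltnP i (size mu); last first.
  rewrite nth_default // minn0 big1 // => k /eqP ki.
  by have := ltn_ord k; rewrite ki ltnNge lei.
rewrite (big_pred1 (Ordinal lti)) // sum1_card.
have -> : #|(fun j : 'I_(nth 0%N mu i) => j < a)%N| =
    #|[set x : 'I_(nth 0%N mu i) | 0 <= x < minn a (nth 0%N mu i)]%N|.
  by apply: eq_card => j; rewrite [LHS]unfold_in [RHS]inE leq_min ltn_ord andbT.
by rewrite card_ord_itv ?subn0 ?geq_minr.
Qed.

Lemma exists_cell i j : (j < nth 0%N mu i)%N ->
  exists2 c : cell mu, crow c = i & ccol c = j.
Proof.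
move=> ltj; have lti : (i < size mu)%N.
  by rewrite ltnNge; apply/negP => lei; rewrite nth_default in ltj.
by exists (Tagged (fun i : 'I_(size mu) => 'I_(nth 0%N mu i))
  (Ordinal ltj : 'I_(nth 0%N mu (Ordinal lti)))).
Qed.

Lemma ccol_lt (c : cell mu) : (ccol c < nth 0 mu (crow c))%N.
Proof. exact: ltn_ord. Qed.

End Cells.

Section RowEnds.

Variables (mu nu : seq nat).
Local Notation l := (size nu).
Implicit Types (T : filling mu nu) (e : nat -> nat -> nat).

(** For fixed k, the numbers [e k i] are the row lengths of the subdiagram formed by the entries
    below k. *)
Definition row_ends T e : Prop :=
  (forall c k, (k <= l)%N -> (T c < k)%N = (ccol c < e k (crow c))%N) /\
  (forall k i, (k <= l)%N -> (e k i <= nth 0 mu i)%N).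

Definition row_count T k i : nat := #|[set c | (crow c == i) && (T c < k)%N]|.

(** Rows increase weakly, so the entries below k fill an initial segment of each row. *)
Lemma ssyt_row_ends T : is_ssyt T -> row_ends T (row_count T).
Proof.
case/and3P=> /forallP rowT _ _; split=> [c k _|k i _].
  have [Tk|kT] := ltnP (T c) k; apply/esym.
    rewrite /row_count -[X in (X <= _)%N](_ : minn (ccol c).+1 (nth 0%N mu (crow
      c)) = _); last first.
      by apply/minn_idPl; exact: ccol_lt.
    rewrite -card_cells_row; apply/subset_leq_card/subsetP => d; rewrite !inE.
    case/andP=> /eqP dc le; rewrite dc eqxx /=; apply: leq_ltn_trans Tk.
    by have /forallP/(_ c)/implyP := rowT d; apply; rewrite dc eqxx -ltnS.
  apply/negbTE; rewrite -leqNgt; apply: leq_trans (geq_minl _ (nth 0%N mu (crow c))).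
  rewrite -card_cells_row; apply/subset_leq_card/subsetP => d; rewrite !inE.
  case/andP=> /eqP dc lt; rewrite dc eqxx ltnNge /=; apply/negP => le.
  have /forallP/(_ d)/implyP := rowT c; rewrite dc eqxx le => /(_ isT) H.
  by have := leq_ltn_trans (leq_trans kT H) lt; rewrite ltnn.
rewrite /row_count -[X in (_ <= X)%N]minnn -card_cells_row.
apply/subset_leq_card/subsetP => d; rewrite !inE => /andP[/eqP <- _].
by rewrite eqxx ccol_lt.
Qed.

Lemma row_countE T e k i : row_ends T e -> (k <= l)%N -> row_count T k i = e k i.
Proof.
case=> Te emu kl; rewrite -[RHS](minn_idPl (emu k i kl)) -card_cells_row.
congr (#|pred_of_set _|); apply/setP => c; rewrite !inE.
by case: eqP => //= <-; rewrite Te.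
Qed.

Lemma row_ends_inj T T' e : row_ends T e -> row_ends T' e -> T = T'.
Proof.
case=> Te _ [T'e _]; apply/ffunP => c; apply/val_inj/anti_leq.
have leT (U U' : filling mu nu) : (forall k,
  (k <= l)%N -> (U c < k)%N = (U' c < k)%N) ->
    (U c <= U' c)%N.
  by move=> /(_ (U' c).+1) H; rewrite -ltnS H // ltn_ord.
by apply/andP; split; apply: leT => k kl; rewrite Te // T'e.
Qed.

Lemma row_multE T e k i : row_ends T e ->
  row_mult T k i = (e k.+1 i - e k i)%N.
Proof.
move=> Te; rewrite -!(row_countE _ Te) ?(ltnW (ltn_ord k)) // /row_mult /row_count.
rewrite -cardsDS; last first.
  by apply/subsetP => c; rewrite !inE => /andP[-> /ltnW].
congr (#|pred_of_set _|); apply/setP => c; rewrite !inE.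
case: (crow c == i) => //=.
by rewrite -leqNgt ltnS -val_eqE eqn_leq andbC.
Qed.

(** In the row above, the entries below T c form an initial segment; those from column [ccol c] on
    are a difference of two initial segments. *)
Lemma rcountE T e c : row_ends T e -> (0 < crow c)%N ->
  rcount T c = (e (T c) (crow c).-1 - ccol c)%N.
Proof.
move=> Te c0; have kl : (T c <= l)%N by rewrite ltnW.
have [Te1 Te2] := Te; rewrite /rcount.
have -> : [set d : cell mu | [&& (crow d).+1 == crow c,
  (ccol c <= ccol d)%N & (T d < T c)%N]] =
    [set d : cell mu | (crow d == (crow c).-1) && (ccol d < e (T c) (crow c).-1)%N]
    :\: [set d : cell mu | (crow d == (crow c).-1) &&
      (ccol d < minn (ccol c) (e (T c) (crow c).-1))%N].
  apply/setP => d; rewrite !inE -{1}(prednK c0) eqSS.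
  case: eqP => //= dc; rewrite Te1 // dc leq_min.
  by rewrite negb_and -leqNgt andb_orl andbC [_ &&
    (_ < _)%N](andbC (~~ _)) andbN orbF andbC.
rewrite cardsDS; last first.
  by apply/subsetP => d; rewrite !inE leq_min => /and3P[-> _ ->].
rewrite !card_cells_row; have := Te2 (T c) (crow c).-1 kl.
by move: (e _ _) (nth _ _ _) (ccol c) => a b x; lia.
Qed.

Lemma card_entries T e k : row_ends T e ->
  #|[set c | T c == k]| = (\sum_(i < size mu) (e k.+1 i - e k i))%N.
Proof.
move=> Te; rewrite -sum1_card (partition_big (fun c : cell mu => tag c) xpredT) //=.
apply: eq_bigr => i _; rewrite -(row_multE _ _ Te) /row_mult -sum1_card.
by apply: eq_bigl => c; rewrite !inE andbC.
Qed.

Section Construction.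

Variable e : nat -> nat -> nat.
Hypothesis e0 : forall i, e 0%N i = 0%N.
Hypothesis e_mono : forall k i, (k < l)%N -> (e k i <= e k.+1 i)%N.
Hypothesis el : forall i, e l i = nth 0%N mu i.

Lemma ends_mono k k' i : (k <= k' <= l)%N -> (e k i <= e k' i)%N.
Proof.
elim: k' => [|k' IH] /andP[kk' k'l]; first by move: kk'; rewrite leqn0 => /eqP ->.
move: kk'; rewrite leq_eqVlt => /orP[/eqP-> //|kk'].
by apply: leq_trans (e_mono _ _); rewrite // IH // (ltnW k'l) andbT -ltnS.
Qed.

(** The entry of a cell is the least k such that stage k + 1 contains the cell. *)
Lemma exists_row_ends : exists T, row_ends T e.
Proof.
have H (c : cell mu) : exists t : 'I_l, forall k, (k <= l)%N ->
    (t < k)%N = (ccol c < e k (crow c))%N.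
  have ex : exists k, (ccol c < e k.+1 (crow c))%N && (k < l)%N.
    have := ccol_lt c; rewrite -el; case El : (size nu) => [|l']; first by rewrite e0.
    by move=> H; exists l'; rewrite H /= leqnn.
  case: (ex_minnP ex) => t /andP[lt tl] tmin; exists (Ordinal tl) => k kl /=.
  apply/idP/idP => [tk|ltk]; first by apply: leq_trans lt _; apply: ends_mono;
    rewrite tk.
  case: k kl ltk => [|k] kl ltk; first by rewrite e0 in ltk.
  by rewrite ltnS tmin // ltk.
have [T HT] := fin_all_exists H.
exists [ffun c => T c]; split=> [c k kl|k i kl]; first by rewrite ffunE HT.
by rewrite -el; apply: ends_mono; rewrite kl leqnn.
Qed.

(** Row i + 1 at stage k + 1 stays within row i at stage k: this is strictness between adjacent
    rows, and monotonicity in k extends it to all rows. *)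
Lemma row_ends_ssyt T :
  row_ends T e ->
  (forall k i, (k < l)%N -> (e k.+1 i.+1 <= e k i)%N) ->
  (forall k, (k < l)%N -> \sum_(i < size mu) (e k.+1 i - e k i) = nth 0 nu k)%N ->
  is_ssyt T.
Proof.
move=> Te interl content; have [Te1 Te2] := Te; apply/and3P; split.
- apply/forallP => c; apply/forallP => d; apply/implyP => /andP[/eqP cd le].
  rewrite -ltnS Te1 ?ltn_ord // cd; apply: leq_ltn_trans le _.
  by rewrite -Te1 ?ltn_ord.
- apply/forallP => c; apply/forallP => d; apply/implyP => /andP[/eqP cd lt].
  have interl' k i i' : (k < l)%N -> (i < i')%N -> (e k.+1 i' <= e k i)%N.
    move=> kl; elim: i' => // i' IH; rewrite ltnS leq_eqVlt => /orP[/eqP->|ii'].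
      exact: interl.
    apply: leq_trans (IH ii'); apply: leq_trans (interl _ _ kl) _.
    exact: e_mono.
  rewrite Te1; last by rewrite ltnW.
  rewrite cd; apply: leq_trans (interl' _ _ _ (ltn_ord (T d)) lt).
  by rewrite -Te1 ?ltn_ord.
by apply/forallP => k; rewrite -content // (card_entries _ Te).
Qed.

End Construction.

End RowEnds.

(** * Tableau weights in terms of row ends *)

Section Tableau.

Variables (mu nu : seq nat).
Local Notation l := (size nu).
Implicit Types (T : filling mu nu) (e : nat -> nat -> nat).

Lemma row_count0 T i : row_count T 0 i = 0%N.
Proof. by apply: eq_card0 => c; rewrite !inE ltn0 andbF. Qed.

Lemma row_count_all T i : row_count T l i = nth 0%N mu i.
Proof.
rewrite -[RHS]minnn -card_cells_row; congr (#|pred_of_set _|); apply/setP => c.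
by rewrite !inE ltn_ord; case: eqP => //= <-; rewrite ccol_lt.
Qed.

Lemma row_countS_ge T k i : (row_count T k i <= row_count T k.+1 i)%N.
Proof.
by apply/subset_leq_card/subsetP => c; rewrite !inE => /andP[-> /ltnW].
Qed.

Lemma row_count_interlaced T k i : sorted geq mu -> is_ssyt T -> (k < l)%N ->
  (row_count T k.+1 i.+1 <= row_count T k i)%N.
Proof.
move=> smu sT kl; have [Te1 Te2] := ssyt_row_ends sT.
have /and3P[_ /forallP colT _] := sT.
rewrite leqNgt; apply/negP => lt.
have mui : (nth 0 mu i.+1 <= nth 0 mu i)%N.
  have [lti|lei] := ltnP i.+1 (size mu); last by rewrite nth_default.
  have tr : transitive geq by move=> x y z xy yz; apply: leq_trans yz xy.
  by apply: (sorted_ltn_nth tr 0%N smu); rewrite ?inE // ltnW.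
(* In row i + 1, take the cell in the first column past the end of row i at stage k. Its entry is at
   most k, so the cell above has an entry below k and should lie before that end. *)
have ltd : (row_count T k i < nth 0 mu i.+1)%N by apply: leq_trans lt (Te2 _ _ kl).
have [d dr dc] := exists_cell ltd.
have [c cr cc] := exists_cell (leq_trans ltd mui).
have Td : (T d < k.+1)%N by rewrite Te1 // dr dc.
have /forallP/(_ d)/implyP := colT c; rewrite cr dr cc dc eqxx ltnSn => /(_ isT) cd.
have : (T c < k)%N by apply: leq_trans cd _; rewrite -ltnS.
by rewrite Te1 ?(ltnW kl) // cr cc ltnn.
Qed.

Section Weights.

Variables (F : fieldType) (q : F).
Hypothesis qfact_neq0 : forall k, qfact q k != 0.

Lemma prod_qint_itv a b A :
  (a <= b)%N -> \prod_(a <= j < b) qint q (A - j) = qffact q (A - a) (b - a).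
Proof.
move=> ab; rewrite -{1}(add0n a) big_addn big_mkord.
by apply: eq_bigr => s _; congr (qint q _); lia.
Qed.

(** The entries k of row i fill the columns from e k i to e (k+1) i, and the one in column j
    contributes [e k (i-1) - j]: together they give a falling product. Padding rows contribute 1. *)
Lemma r_q_row_ends T e n :
  row_ends T e -> (forall k i,
    (k < l)%N -> (e k i <= e k.+1 i)%N) -> (size mu <= n.+1)%N ->
  r_q q T =
  \prod_(k < l) \prod_(j < n) qffact q (e k j - e k j.+1) (e k.+1 j.+1 - e k j.+1).
Proof.
move=> Te emono szn; have [Te1 Te2] := Te.
have e_out k i : (k <= l)%N -> (size mu <= i)%N -> e k i = 0%N.
  by move=> kl lei; apply/eqP; rewrite -leqn0 -(nth_default 0%N lei) Te2.
rewrite /r_q (partition_big T xpredT) //=; apply: eq_bigr => k _.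
have kl : (k <= l)%N by rewrite ltnW.
rewrite (eq_big (fun c : cell mu =>
  (0 < crow c)%N && (e k (crow c) <= ccol c < e k.+1 (crow c))%N)
   (fun c : cell mu => qint q (e k (crow c).-1 - ccol c))); last first.
- by move=> c /andP[c0 /eqP Tk]; rewrite (rcountE Te) // Tk.
- move=> c; congr (_ && _); rewrite -Te1 // [X in X && _]leqNgt -Te1 // -leqNgt ltnS.
  by rewrite -val_eqE eqn_leq andbC.
rewrite (big_cells _ _ (fun i => 0 < i)%N (fun i j => e k i <= j < e k.+1 i)%N
  (fun i j => qint q (e k i.-1 - j))).
transitivity (\prod_(i < size mu |
  (0 < i)%N) qffact q (e k i.-1 - e k i) (e k.+1 i - e k i)).
  apply: eq_bigr => i _; rewrite -prod_qint_itv ?emono //.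
  rewrite -(big_mkord (fun j => e k i <= j < e k.+1 i)%N (fun j =>
    qint q (e k i.-1 - j))).
  by rewrite [RHS](big_nat_widenl _ 0) // [RHS](big_nat_widen _ _ (nth 0%N mu i))
    ?Te2 //.
rewrite (big_ord_widen_cond n.+1 (fun i => 0 < i)%N
  (fun i => qffact q (e k i.-1 - e k i) (e k.+1 i - e k i))) //.
rewrite big_mkcond big_ord_recl /= mul1r; apply: eq_bigr => j _; rewrite /bump /= add1n.
case: ltnP => // le; rewrite (e_out k.+1) //.
by rewrite sub0n /qffact big_ord0.
Qed.

Lemma s_q_row_ends T e n :
  row_ends T e -> (size mu <= n.+1)%N ->
  s_q q T =
  \prod_(k < l) (qfact q (nth 0%N nu k) / \prod_(i < n.+1) qfact q (e k.+1 i - e k i)).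
Proof.
move=> Te szn; have [Te1 Te2] := Te.
have e_out k i : (k <= l)%N -> (size mu <= i)%N -> e k i = 0%N.
  by move=> kl lei; apply/eqP; rewrite -leqn0 -(nth_default 0%N lei) Te2.
apply: eq_bigr => k _; congr (_ / _).
rewrite big_map -[X in iota 0 X]subn0 -/(index_iota 0 (size mu)) big_mkord.
rewrite (big_ord_widen n.+1 (fun i => qfact q (row_mult T k i))) //.
rewrite big_mkcond; apply: eq_bigr => i _; rewrite (row_multE _ _ Te).
by case: ltnP => // le; rewrite (e_out k.+1) // sub0n qfact0.
Qed.

End Weights.

End Tableau.

(** * Matching tableau weights with strip weights *)

Section Paths.

Variables (n : nat) (F : fieldType) (q : F) (nu : seq nat).
Hypothesis qfact_neq0 : forall k, qfact q k != 0.

Local Notation l := (size nu).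
Local Notation diagram := (diagram n).
Local Notation dpath := {ffun 'I_l.+1 -> diagram}.
Local Notation strip_path_weight :=
  (path_weight (fun k => @strip_weight n F q (nth 0%N nu k))).

Definition interlaced (v' v : diagram) : bool := [forall j,
  v (srow j) <= v' (prow j)]%N.

Definition tableau_path (L : dpath) : bool :=
  (L ord0 == empty_shape n) &&
  [forall k : 'I_l, extends (nth 0%N nu k) (L (prow k)) (L (srow k))
             && interlaced (L (prow k)) (L (srow k))].

Definition path_ends (L : dpath) k i : nat :=
  if (i <= n)%N then nat_of_ord (L (inord k) (inord i)) else 0%N.

Lemma path_endsE (L : dpath) (k : 'I_l.+1) (i : 'I_n.+1) : path_ends L k i = L k i.
Proof. by rewrite /path_ends -ltnS ltn_ord !inord_val. Qed.

Lemma path_ends_prow (L : dpath) (k : 'I_l) (i : 'I_n.+1) : path_ends L k i =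
  L (prow k) i.
Proof. by rewrite -path_endsE. Qed.

Lemma path_ends_srow (L : dpath) (k : 'I_l) (i : 'I_n.+1) : path_ends L k.+1 i =
  L (srow k) i.
Proof. by rewrite -path_endsE. Qed.

(** Below the first row, a falling product divided by [b]! is a Gaussian binomial. The first row has
    no r-factor and leaves [c]!/[b0]!. *)
Lemma tableau_weight (mu : seq nat) (T : filling mu nu) (L : dpath) :
  (size mu <= n.+1)%N -> tableau_path L -> row_ends T (path_ends L) ->
  r_q q T * s_q q T = strip_path_weight L.
Proof.
move=> szn /andP[_ /forallP HL] Te.
have ext (k : 'I_l) : extends (nth 0%N nu k) (L (prow k)) (L (srow k)) by
  case/andP: (HL k).
have mono k i : (k < l)%N -> (path_ends L k i <= path_ends L k.+1 i)%N.
  move=> kl; rewrite /path_ends; have [ni|//] := leqP i n.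
  have /andP[/forallP/(_ (inord i)) + _] := ext (Ordinal kl).
  by rewrite -path_ends_prow -path_ends_srow /path_ends inordK //= ni.
rewrite (r_q_row_ends q Te mono szn) (s_q_row_ends q Te szn) -big_split /=.
apply: eq_bigr => k _; rewrite /strip_weight ext.
rewrite big_ord_recl.
rewrite (eq_bigr (fun j : 'I_n =>
   qbin q (L (prow k) (prow j) - L (prow k) (srow j)) (L (srow k) (srow j) - L
     (prow k) (srow j))
   * qfact q (L (srow k) (srow j) - L (prow k) (srow j)))); last first.
  move=> j _; rewrite -qffact_qbin -!path_ends_prow -!path_ends_srow.
  by congr (qffact q _ _).
rewrite [X in _ / (_ * X)](eq_bigr (fun j : 'I_n =>
   qfact q (L (srow k) (srow j) - L (prow k) (srow j)))); last first.
  by move=> j _; rewrite -!path_ends_prow -!path_ends_srow.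
rewrite big_split /= (path_ends_srow L k ord0) (path_ends_prow L k ord0).
set b0 := (L (srow k) ord0 - _)%N.
have b0c : (b0 <= nth 0 nu k)%N.
  have /andP[/forallP le /eqP sz] := ext k; rewrite /b0 leq_subLR.
  have := sz; rewrite /shape_size !big_ord_recl => sz'.
  have : (\sum_(j < n) L (prow k) (lift ord0 j) <= \sum_(j < n) L (srow k) (lift
    ord0 j))%N.
    by apply: leq_sum.
  by move: sz'; move: (\sum_(i < n) _)%N (\sum_(i < n) _)%N => S1 S2; lia.
rewrite (@qfact_qffact _ q (nth 0%N nu k) (nth 0%N nu k - b0)) ?leq_subr // subKn //.
have nz1 := qfact_neq0 b0.
have nz2 : \prod_(j < n) qfact q (L (srow k) (srow j) - L (prow k) (srow j)) != 0.
  by apply/prodf_neq0 => j _; apply: qfact_neq0.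
by field; rewrite nz1 nz2.
Qed.

End Paths.

(** * The tableau side *)

Section TableauSums.

Variables (n : nat) (F : fieldType) (q : F) (nu : seq nat).
Hypothesis qfact_neq0 : forall k, qfact q k != 0.
Hypothesis nun : sumn nu = n.

Local Notation l := (size nu).
Local Notation diagram := (diagram n).
Local Notation dpath := {ffun 'I_l.+1 -> diagram}.
Local Notation strip_path_weight :=
  (path_weight (fun k => @strip_weight n F q (nth 0%N nu k))).

Definition diagram_of (mu : seq nat) : diagram := [ffun i : 'I_n.+1 =>
  inord (nth 0%N mu i)].

Definition path_of (mu : seq nat) (T : filling mu nu) : dpath :=
  [ffun k : 'I_l.+1 => [ffun i : 'I_n.+1 => inord (row_count T k i)]].

Section FixedShape.

Variable mu : seq nat.
Hypothesis part_mu : is_part n mu.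

Lemma part_nth_le i : (nth 0 mu i <= n)%N.
Proof.
have /and3P[_ _ /eqP <-] := part_mu.
elim: (mu) i => [|k s IH] [|i] //=; first exact: leq_addr.
by apply: leq_trans (IH i) (leq_addl _ _).
Qed.

Lemma part_size_le : (size mu <= n)%N.
Proof.
have /and3P[_ + /eqP <-] := part_mu; elim: (mu) => //= k s IH /andP[k0 /IH].
by rewrite -add1n; apply: leq_add.
Qed.

Lemma diagram_ofE i : diagram_of mu i = nth 0%N mu i :> nat.
Proof. by rewrite ffunE inordK // ltnS part_nth_le. Qed.

Lemma path_ofE (T : filling mu nu) (k : 'I_l.+1) i :
  is_ssyt T -> path_of T k i = row_count T k i :> nat.
Proof.
move=> sT; rewrite 2!ffunE inordK // ltnS; have [_ Te] := ssyt_row_ends sT.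
by apply: leq_trans (Te k i _) (part_nth_le i); rewrite -ltnS.
Qed.

Lemma path_ends_path_of (T : filling mu nu) :
  is_ssyt T -> row_ends T (path_ends (path_of T)).
Proof.
move=> sT; have [Te1 Te2] := ssyt_row_ends sT.
have E k i : (k <= l)%N -> path_ends (path_of T) k i = row_count T k i.
  move=> kl; rewrite /path_ends; case: leqP => ni.
    by rewrite path_ofE // !inordK.
  apply/esym/eqP; rewrite -leqn0; apply: leq_trans (Te2 _ _ kl) _.
  by rewrite nth_default // (leq_trans part_size_le) // ltnW.
by split=> [c k kl|k i kl]; rewrite E // ?Te1 // Te2.
Qed.

Lemma content_widen (T : filling mu nu) e (k : 'I_l) : row_ends T e ->
  (\sum_(i < size mu) (e k.+1 i - e k i) = \sum_(i < n.+1) (e k.+1 i - e k i))%N.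
Proof.
case=> _ Te; rewrite (big_ord_widen n.+1 (fun i => e k.+1 i - e k i)%N); last first.
  by apply: leqW; apply: part_size_le.
rewrite big_mkcond; apply: eq_bigr => i _; case: ltnP => // le.
have := Te k.+1 i (ltn_ord k); rewrite nth_default // leqn0 => /eqP ->.
by [].
Qed.

Lemma path_of_tableau_path (T : filling mu nu) :
  is_ssyt T -> tableau_path (path_of T) && (path_of T ord_max == diagram_of mu).
Proof.
move=> sT; have Te := ssyt_row_ends sT.
have /and3P[smu _ _] := part_mu.
apply/andP; split; last first.
  apply/eqP/ffunP => i; apply: val_inj => /=.
  by rewrite path_ofE // diagram_ofE row_count_all.
apply/andP; split.
  by apply/eqP/ffunP => i; apply: val_inj => /=; rewrite path_ofE // row_count0 ffunE.
apply/forallP => k; apply/andP; split; last first.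
  by apply/forallP => j; rewrite !path_ofE //= row_count_interlaced.
apply/andP; split; first by apply/forallP => i; rewrite !path_ofE //= row_countS_ge.
have /and3P[_ _ /forallP/(_ k)/eqP <-] := sT.
rewrite (card_entries _ Te) (content_widen _ Te) /shape_size -big_split /=.
by apply/eqP/eq_bigr => i _; rewrite !path_ofE //= subnKC // row_countS_ge.
Qed.

Lemma exists_tableau (L : dpath) :
  tableau_path L -> L ord_max = diagram_of mu ->
  exists2 T : filling mu nu, is_ssyt T & row_ends T (path_ends L).
Proof.
move=> /andP[/eqP L0 /forallP HL] Lmax.
have ext (k : 'I_l) : extends (nth 0%N nu k) (L (prow k)) (L (srow k)) by
  case/andP: (HL k).
have e0 i : path_ends L 0 i = 0%N.
  rewrite /path_ends; case: leqP => // ni.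
  by rewrite (_ : inord 0 = ord0) ?L0 ?ffunE //; apply: val_inj; rewrite /= inordK.
have emono k i : (k < l)%N -> (path_ends L k i <= path_ends L k.+1 i)%N.
  move=> kl; rewrite /path_ends; have [ni|//] := leqP i n.
  have /andP[/forallP/(_ (inord i)) + _] := ext (Ordinal kl).
  by rewrite -path_ends_prow -path_ends_srow /path_ends inordK //= ni.
have el i : path_ends L l i = nth 0%N mu i.
  rewrite /path_ends; case: leqP => ni; last first.
    by rewrite nth_default // (leq_trans part_size_le) // ltnW.
  rewrite (_ : inord l = ord_max); last by apply: val_inj; rewrite /= inordK.
  by rewrite Lmax diagram_ofE inordK.
have [T Te] := exists_row_ends e0 emono el; exists T => //.
apply: (row_ends_ssyt emono Te) => [k i kl|k kl].
  have [lti|lei] := ltnP i n; last by rewrite {1}/path_ends ltnNge lei.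
  have /andP[_ /forallP/(_ (Ordinal lti))] := HL (Ordinal kl).
  by rewrite -path_ends_prow -path_ends_srow.
rewrite -[k]/(val (Ordinal kl)) (content_widen _ Te).
have /andP[/forallP le /eqP sz] := ext (Ordinal kl).
apply/(@addnI (shape_size (L (prow (Ordinal kl))))); rewrite -sz.
rewrite /shape_size -big_split /=; apply: eq_bigr => i _.
by rewrite -[k]/(val (Ordinal kl)) path_ends_prow path_ends_srow subnKC.
Qed.

(** A tableau amounts to the chain of its subdiagrams: each fibre of [path_of] over an admissible
    path is a single tableau. *)
Lemma b_q_paths :
  b_q q mu nu =
  \sum_(L : dpath | tableau_path L && (L ord_max == diagram_of mu)) strip_path_weight L.
Proof.
rewrite /b_q (partition_big (@path_of mu)
  (fun L => tableau_path L && (L ord_max == diagram_of mu))) /=; last first.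
  exact: path_of_tableau_path.
apply: eq_bigr => L /andP[HL /eqP Lmax].
have [T0 sT0 Te0] := exists_tableau HL Lmax.
rewrite (big_pred1 T0) => [|T /=].
  by apply: tableau_weight => //; apply: leqW; apply: part_size_le.
apply/andP/eqP => [[sT /eqP eqL]|->].
  by apply: row_ends_inj Te0; rewrite -eqL; apply: path_ends_path_of.
split=> //; apply/eqP/ffunP => k; apply/ffunP => i; apply: val_inj => /=.
by rewrite path_ofE // (row_countE _ Te0) ?path_endsE // -ltnS.
Qed.

End FixedShape.

Lemma eq_from_nth_pos (s s' : seq nat) :
  all (leq 1) s -> all (leq 1) s' -> nth 0%N s =1 nth 0%N s' -> s = s'.
Proof.
elim: s s' => [|x s IH] [|x' s'] //=.
- by move=> _ /andP[x'_gt0 _] /(_ 0%N) /= x'0; rewrite -x'0 in x'_gt0.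
- by move=> /andP[x_gt0 _] _ /(_ 0%N) /= x0; rewrite x0 in x_gt0.
move=> /andP[_ ps] /andP[_ ps'] E; have /= -> := E 0%N; rewrite (IH s') // => i.
exact: (E i.+1).
Qed.

Lemma nth_filter_pos (s : seq nat) i :
  sorted geq s -> nth 0%N [seq x <- s | 0 < x]%N i = nth 0%N s i.
Proof.
elim: s i => //= x s IH i ps; have ss := path_sorted ps.
case: posnP => [x0|_]; last by case: i => //= i; apply: IH.
have all0 : all (geq x) s.
  by apply: order_path_min ps => a b c ab bc; apply: leq_trans bc ab.
rewrite IH //; have z j : nth 0%N s j = 0%N.
  have [ltj|lej] := ltnP j (size s); last by rewrite nth_default.
  by have /allP/(_ _ (mem_nth 0%N ltj)) := all0; rewrite /geq /= x0 leqn0 => /eqP.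
by rewrite z; case: i => //= i; rewrite z.
Qed.

(** The partition is recovered by dropping the empty rows of v; its uniqueness collapses the sum
    over mu in [S_q] once the path is fixed. *)
Lemma exists_partition (v : diagram) :
  nonincreasing v -> shape_size v = n ->
  exists mu : {bseq n of 'I_n.+1}, forall mu' : {bseq n of 'I_n.+1},
    is_part n (seq_of_bseq mu') && (diagram_of (seq_of_bseq mu') == v) = (mu' == mu).
Proof.
move=> dec sz; pose s := [seq val (v i) | i <- enum 'I_n.+1].
have ns i : nth 0%N s i = if (i < n.+1)%N then val (v (inord i)) else 0%N.
  case: ltnP => lti; last by rewrite nth_default // size_map size_enum_ord.
  rewrite (nth_map ord0) ?size_enum_ord //; congr (val (v _)); apply: val_inj.
  by rewrite /= nth_enum_ord // inordK.
have ss : sorted geq s.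
  apply/(sortedP 0%N) => i; rewrite size_map size_enum_ord => lti.
  rewrite !ns lti (ltnW lti) /=; apply: nonincreasing_le => //.
  by rewrite !inordK // ltnW.
pose s' := [seq x <- s | 0 < x]%N.
have ps' : is_part n s'.
  apply/and3P; split.
  - by apply: sorted_filter ss => a b c ab bc; apply: leq_trans bc ab.
  - by apply/allP => x; rewrite mem_filter => /andP[].
  rewrite -[X in _ == X]sz /shape_size -[X in _ == X]big_enum /= sumnE big_filter.
  rewrite big_map big_mkcond /=; apply/eqP; apply: eq_bigr => i _.
  by case: posnP.
have [mu [mus uniq_mu]] := is_part_bseq ps'.
exists mu => mu'; apply/andP/eqP => [[pmu' /eqP vmu']|->].
  apply/esym/uniq_mu/eq_from_nth_pos; [by case/and3P: pmu'|by case/and3P: ps'|].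
  move=> i; rewrite nth_filter_pos // ns -vmu'; case: ltnP => lti.
    by rewrite /= diagram_ofE // inordK.
  by rewrite nth_default // (leq_trans (part_size_le pmu')) // ltnW.
rewrite mus; split=> //; apply/eqP/ffunP => i; apply: val_inj => /=.
by rewrite diagram_ofE // nth_filter_pos // ns ltn_ord inord_val.
Qed.

Lemma S_q_first_row_sum m : S_q q n m nu = first_row_sum n q nu l m.
Proof.
rewrite /S_q.
pose P (mu : {bseq n of 'I_n.+1}) := is_part n (seq_of_bseq mu) &&
  (nth 0%N (seq_of_bseq mu) 0 == m).
transitivity (\sum_(mu | P mu) \sum_(L : dpath | tableau_path L &&
  (L ord_max == diagram_of (seq_of_bseq mu)))
   strip_path_weight L * q ^+ shape_exp (L ord_max)).
  apply: eq_bigr => mu /andP[pmu _]; rewrite b_q_paths // mulr_sumr.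
  apply: eq_bigr => L /andP[_ /eqP ->]; rewrite mulrC; congr (_ * q ^+ _).
  rewrite /shape_exp -(size_map val mu) -/(seq_of_bseq mu).
  have szmu := part_size_le pmu.
  (* The range 1 <= j drops the first row, and rows past the end of mu contribute C(0,2) = 0. *)
  rewrite big_geq_mkord (big_ord_widen_cond n.+1 (fun j => 1 <= j)%N
     (fun j => 'C(nth 0%N (seq_of_bseq mu) j, 2))) ?leqW //.
  rewrite big_mkcond big_ord_recl /= add0n; apply: eq_bigr => j _.
  rewrite diagram_ofE //= /bump /=; case: ltnP => // le.
  by rewrite nth_default.
rewrite (exchange_big_dep (fun L => tableau_path L)) /=; last by move=> mu L _ /andP[].
rewrite /first_row_sum [RHS](bigID (fun L => tableau_path L)) /=.
(* Paths starting at the empty shape that fail [tableau_path] have weight zero. *)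
rewrite [X in _ = _ + X]big1 ?addr0; last first.
  move=> L /andP[/eqP L0 nL]; have [->|nz] := eqVneq (strip_path_weight L) 0.
    by rewrite mul0r.
  case/negP: nL; rewrite /tableau_path L0 eqxx /=; apply/forallP => k.
  have /prodf_neq0/(_ k isT) nzk := nz.
  have [dec _] := strip_path_shapes (prow k) (leqnn _) L0 nz.
  have [ext _] := strip_weight_neq0 nzk; rewrite ext /=.
  by have [_ int] := strip_nonincreasing nzk dec; apply/forallP.
rewrite [RHS](eq_bigl (fun L => tableau_path L)); last first.
  by move=> L; rewrite /tableau_path; case: (L ord0 == _); rewrite //= andbF.
apply: eq_bigr => L HL; have [->|nz] := eqVneq (strip_path_weight L) 0.
  by rewrite !mul0r big1.
have L0 : L ord0 = empty_shape n by case/andP: HL => /eqP.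
have [dec sz] := strip_path_shapes ord_max (leqnn _) L0 nz.
rewrite take_size nun in sz.
have [mu Hmu] := exists_partition dec sz.
have Emu mu' : P mu' && (tableau_path L &&
  (L ord_max == diagram_of (seq_of_bseq mu'))) =
    (mu' == mu) && (L ord_max ord0 == m :> nat).
  rewrite HL /= [L ord_max == _]eq_sym /P -andbA [(_ == m) && _]andbC andbA Hmu.
  case: eqP => //= e; have := Hmu mu'; rewrite e eqxx => /andP[pmu /eqP <-].
  by rewrite diagram_ofE.
rewrite (eq_bigl _ _ Emu); case: eqP => _.
  by rewrite (big_pred1 mu) // => mu'; rewrite andbT.
by rewrite mulr0 big_pred0 // => mu'; rewrite andbF.
Qed.

End TableauSums.

(** Both families have the same initial values and obey the recurrence with coefficients
    [strip_coef], one part of nu at a time. *)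
Lemma normalized_sum_first_row_sum n (F : fieldType) (q : F) nu k m :
  q != 0 -> sumn nu = n -> (k <= size nu)%N -> (m <= n)%N ->
  normalized_sum n (offset nu) q (sumn (take k nu)) m = first_row_sum n q nu k m.
Proof.
move=> q0 nun; elim: k m => [|k IH] m kl mn.
  by rewrite take0 normalized_sum0 first_row_sum0.
rewrite sumn_take_next // normalized_sum_strip //.
- rewrite first_row_sumS //; apply: eq_bigr => m' _; rewrite IH //; first exact: ltnW.
  by rewrite -ltnS.
- exact: offsetS.
- exact: offset_le.
- move=> j jk; rewrite (@offset_take _ k) ?addKn // leq_addr sumn_take_next //.
  by rewrite ltn_add2l.
by rewrite -sumn_take_next // -nun sumn_take_le.
Qed.

Lemma S_q_eq_St_q (F : fieldType) (q : F) n m nu :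
  q != 0 -> (forall k, qfact q k != 0) -> sumn nu = n ->
  S_q q n m nu = St_q q n m nu.
Proof.
move=> q0 qf nun.
have [mn|nm] := leqP m n.
  rewrite S_q_first_row_sum // St_q_normalized_sum //.
  by rewrite -normalized_sum_first_row_sum // take_size nun.
(* For m > n both sums are empty: parts are at most n, and a partition of [n] has as many blocks as
   block maxima. *)
rewrite /S_q big_pred0; last first.
  move=> mu; apply/negbTE; rewrite negb_and -implybE; apply/implyP => pmu.
  by apply: contraTneq nm => <-; rewrite -leqNgt part_nth_le.
rewrite /St_q big_pred0 // => A; apply/negbTE/negP => /and3P[pA /eqP Am _].
have := card_maxima pA; rewrite Am => H; have := max_card (mem (maxima A)).
by rewrite H card_ord leqNgt nm.
Qed.

(** * Nonvanishing at the indeterminate *)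

Lemma qvar_neq0 : qvar != 0.
Proof. by rewrite /qvar tofrac_eq0 polyX_eq0. Qed.

Lemma qint_qvar_neq0 k : qint qvar k.+1 != 0.
Proof.
have -> : qint qvar k.+1 = tofrac (\sum_(i < k.+1) 'X^i).
  by rewrite /qint rmorph_sum; apply: eq_bigr => i _; rewrite rmorphXn.
(* Evaluating the polynomial at 1 gives k + 1, which is nonzero in characteristic 0. *)
rewrite tofrac_eq0; apply: contraTneq isT => /(congr1 (fun p : {poly rat} => p.[1])).
rewrite horner_sum horner0 (eq_bigr (fun=> 1)); last first.
  by move=> i _; rewrite hornerXn expr1n.
by rewrite sumr_const card_ord => /eqP; rewrite pnatr_eq0.
Qed.

Lemma qfact_qvar_neq0 k : qfact qvar k != 0.
Proof.
elim: k => [|k IH]; first by rewrite qfact0 oner_neq0.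
by rewrite qfactS; apply: mulf_neq0 IH (qint_qvar_neq0 k).
Qed.

Theorem theorem7p7 (n m : nat) (nu : seq nat) :
  (0 < n)%N -> is_part n nu -> S_q qvar n m nu = St_q qvar n m nu.
Proof.
move=> _ /and3P[_ _ /eqP nun].
exact (S_q_eq_St_q m qvar_neq0 qfact_qvar_neq0 nun).
Qed.
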